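(* Let $\Gamma=(V,H)$ be an oriented hypergraph on $n$ vertices with only inputs (i.e. $h_{out}=\emptyset$ for every $h\in H$), in which no vertex has degree zero, and let $p\ge1$. If $f$ is an eigenfunction of $\Delta_p$ for the $k$-th min-max eigenvalue $\lambda_k(\Delta_p)$, and $\lambda_k(\Delta_p)$ has multiplicity $r$, then the total number of positive and negative nodal domains of $f$ is at most $n-k+r$.
   Context: An oriented hypergraph $\Gamma=(V,H)$ consists of a finite vertex set $V=\{1,\dots,n\}$ and a finite set $H$ of hyperedges, each a pair $(h_{in},h_{out})$ of disjoint subsets of $V$ with nonempty union; $i\in h$ means $i\in h_{in}\cup h_{out}$. $\deg(i)$ = number of hyperedges containing $i$ (assumed $\ge1$). Let $\mathcal{I}^h(i)$ be $1$ if $i\in h_{in}$, $-1$ if $i\in h_{out}$, $0$ otherwise, and $\langle\mathcal{I}^h,f\rangle=\sum_{i\in h_{in}}f(i)-\sum_{j\in h_{out}}f(j)$. For $p>1$: $\Delta_pf(i)=\frac1{\deg(i)}\sum_{h\ni i}\mathcal{I}^h(i)|\langle\mathcal{I}^h,f\rangle|^{p-2}\langle\mathcal{I}^h,f\rangle$ (with $|0|^{p-2}\cdot0=0$), and $(\lambda,f)$, $f\ne0$, is an eigenpair if $\Delta_pf=\lambda|f|^{p-2}f$. For $p=1$: $(\lambda,f)$, $f\ne0$, is an eigenpair if there exist $z_i\in\mathrm{Sgn}(f(i))$, $z_h\in\mathrm{Sgn}(\langle\mathcal{I}^h,f\rangle)$ with $\sum_{h:\,i\in h_{in}}z_h-\sum_{h:\,i\in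 h_{out}}z_h=\lambda\deg(i)z_i$ for all $i$, where $\mathrm{Sgn}(t)=\{\mathrm{sign}(t)\}$ for $t\ne0$ and $[-1,1]$ for $t=0$. $\mathrm{RQ}_p(f)=\frac{\sum_h|\langle\mathcal{I}^h,f\rangle|^p}{\sum_i\deg(i)|f(i)|^p}$. Krasnoselskii genus: for centrally symmetric $S\subseteq\mathbb{R}^n$, $\mathrm{gen}(S)$ is the least $k\ge1$ admitting an odd continuous map $S\setminus\{0\}\to\mathbb{S}^{k-1}$ ($0$ if $S\setminus\{0\}=\emptyset$); $\mathrm{Gen}_k$ = centrally symmetric sets of genus $\ge k$. The $k$-th min-max eigenvalue is $\lambda_k(\Delta_p)=\inf_{S\in\mathrm{Gen}_k}\sup_{f\in S\setminus\{0\}}\mathrm{RQ}_p(f)$. An eigenvalue $\lambda$ has multiplicity $r$ if the genus of its set of eigenfunctions is $r$. Let $\mathrm{supp}_\pm(f)=\{i:\pm f(i)>0\}$. A positive (resp. negative) nodal domain of $f$ is a connected component of the hypergraph on vertex set $\mathrm{supp}_+(f)$ (resp. $\mathrm{supp}_-(f)$) with hyperedges $(h_{in}\cap\mathrm{supp}_\pm(f),h_{out}\cap\mathrm{supp}_\pm(f))$, $h\in H$. *)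

(* Defs.v *)
From HB Require Import structures.
From mathcomp Require Import all_boot all_order all_algebra.
From mathcomp Require Import all_classical all_reals all_analysis.

Set Implicit Arguments.
Unset Strict Implicit.
Unset Printing Implicit Defensive.

Import Order.TTheory GRing.Theory Num.Theory.
Import numFieldNormedType.Exports.

Local Open Scope ring_scope.

(* A hyperedge is a pair (h_in, h_out). *)
Definition hyperedge (n : nat) := ({set 'I_n} * {set 'I_n})%type.

Definition hsupp n (h : hyperedge n) : {set 'I_n} := h.1 :|: h.2.

Record ohypergraph (n : nat) := OHypergraph {
  hedges : {set hyperedge n};
  hedges_disjoint : forall h, h \in hedges -> [disjoint h.1 & h.2];
  hedges_nonempty : forall h, h \in hedges -> hsupp h != finset.set0 }.

Definition inputs_only n (G : ohypergraph n) : Prop :=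
  forall h, h \in hedges G -> h.2 = finset.set0.

Definition deg n (G : ohypergraph n) (i : 'I_n) : nat :=
  #|[set h in hedges G | i \in hsupp h]|.

Section Components.
Variables (n : nat).
Implicit Types (E : {set hyperedge n}) (A : {set 'I_n}).

Definition hrestrict E A : {set hyperedge n} :=
  [set (h.1 :&: A, h.2 :&: A) | h in E].

Definition hadj E : rel 'I_n :=
  fun i j => [exists h in E, (i \in hsupp h) && (j \in hsupp h)].

(* The connected components of the hypergraph with vertex set A and hyperedge
   set E, as a set of blocks. *)
Definition hcomponents E A : {set {set 'I_n}} :=
  equivalence_partition (connect (hadj E)) A.

End Components.

Section NodalDomains.
Variables (R : realType) (n : nat) (G : ohypergraph n).
Implicit Types f : 'rV[R]_n.

Definition supp_pos f : {set 'I_n} := [set i | 0 < f 0 i].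
Definition supp_neg f : {set 'I_n} := [set i | 0 < - f 0 i].

Definition pos_nodal_domains f : {set {set 'I_n}} :=
  hcomponents (hrestrict (hedges G) (supp_pos f)) (supp_pos f).
Definition neg_nodal_domains f : {set {set 'I_n}} :=
  hcomponents (hrestrict (hedges G) (supp_neg f)) (supp_neg f).

End NodalDomains.

Local Open Scope classical_set_scope.

Section PLaplacian.
Variables (R : realType) (n : nat) (G : ohypergraph n).
Implicit Types (p lam : R) (f : 'rV[R]_n) (h : hyperedge n).

Definition incidence h (i : 'I_n) : R :=
  if i \in h.1 then 1 else if i \in h.2 then -1 else 0.

Definition hpair h f : R :=
  \sum_(i in h.1) f 0 i - \sum_(j in h.2) f 0 j.

(* |t|^(p-2) t; the factor t makes it vanish at 0 for every p. *)
Definition signed_pow p (t : R) : R := `|t| `^ (p - 2) * t.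

Definition plaplacian p f : 'rV[R]_n :=
  \row_i ((deg G i)%:R^-1 *
    \sum_(h in hedges G | i \in hsupp h)
       incidence h i * signed_pow p (hpair h f)).

Definition Sgn (t : R) : set R :=
  if t == 0 then `[-1, 1]%classic else [set Num.sg t].

Definition eigenpair1 lam f : Prop :=
  exists (zv : 'I_n -> R) (zh : hyperedge n -> R),
    [/\ forall i, Sgn (f 0 i) (zv i),
        forall h, h \in hedges G -> Sgn (hpair h f) (zh h) &
        forall i,
          \sum_(h in hedges G | i \in h.1) zh h
          - \sum_(h in hedges G | i \in h.2) zh h
          = lam * (deg G i)%:R * zv i].

Definition eigenpair p lam f : Prop :=
  f <> 0 /\
  (if p == 1 then eigenpair1 lam f
   else forall i, plaplacian p f 0 i = lam * signed_pow p (f 0 i)).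

Definition RQ p f : R :=
  (\sum_(h in hedges G) `|hpair h f| `^ p) /
  (\sum_i (deg G i)%:R * `|f 0 i| `^ p).

End PLaplacian.

Section Genus.
Variables (R : realType) (n : nat).
Implicit Types S : set 'rV[R]_n.

Definition centrally_symmetric S : Prop := forall x, S x -> S (- x).

(* The sphere S^(k-1), as a subset of R^k. *)
Definition unit_sphere k : set 'rV[R]_k := [set y | \sum_i y 0 i ^+ 2 = 1].

Definition odd_map_to_sphere S (k : nat) : Prop :=
  exists g : 'rV[R]_n -> 'rV[R]_k,
    [/\ {within S `\ 0, continuous g},
        forall x, (S `\ 0) x -> unit_sphere (g x) &
        forall x, (S `\ 0) x -> g (- x) = - g x].

Definition is_least_dim S (k : nat) : Prop :=
  [/\ (1 <= k)%N, odd_map_to_sphere S k &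
      forall j, (1 <= j)%N -> odd_map_to_sphere S j -> (k <= j)%N].

(* The default value of xget is never used: on a nonempty S `\ 0 the map
   x |-> x / |x|_2 shows that a least dimension exists and is at most n. *)
Definition genus S : nat :=
  if `[< S `\ 0 = set0 >] then 0%N else xget 0%N [set k | is_least_dim S k].

Definition Gen (k : nat) : set (set 'rV[R]_n) :=
  [set S | centrally_symmetric S /\ (k <= genus S)%N].

End Genus.

Section MinMax.
Variables (R : realType) (n : nat) (G : ohypergraph n).

(* Infimum and supremum are taken in \bar R, so that no boundedness or
   nonemptiness side condition is hidden in a default value. *)
Definition minmax_eigenvalue (p : R) (k : nat) : \bar R :=
  ereal_inf [set ereal_sup [set (RQ G p f)%:E | f in S `\ 0]
            | S in @Gen R n k].

Definition multiplicity (p lam : R) : nat :=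
  genus [set f : 'rV[R]_n | eigenpair G p lam f].

End MinMax.

(* Main.v *)
Require Import Defs.
From mathcomp Require Import all_boot all_order all_algebra.
From mathcomp Require Import all_classical all_reals all_analysis.
From mathcomp Require Import ring lra zify.

(** Write [A x = \sum_h |<h, x>|^p], [B x = \sum_i deg i |x i|^p] and
    [J = A - lam B], where [lam] is the [k]-th min-max eigenvalue, and let [m] be
    the number of nodal domains of [f].

    All hyperedges being inputs, each of them meets at most one positive and one
    negative nodal domain, and convexity of [|.|^p] together with the eigenvalue
    equation gives [J >= 0] on the [m]-dimensional span [X] of the restrictions
    of [f] to its nodal domains. Let [pi] be a linear map onto [R^(n - m)] with
    kernel [X].

    An odd map from the eigenfunctions of norm one to the sphere of dimension
    [r - 1] extends, by Tietze's theorem, to an odd map [Psi] on [R^n]. Let [eta]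
    be an odd map of the unit sphere which strictly decreases [J] wherever
    [Psi = 0]. Then [(Psi, pi o eta)] has no zero on [J <= 0], hence by
    compactness none on [RQ < mu] for some [mu > lam]; a set of genus at least
    [k] on which [RQ < mu] yields [k <= r + (n - m)].

    For [p > 1], [eta] is a short explicit gradient step. For [p = 1] it is an
    implicit step: with [c] in [lam] times the subdifferential of [B] at [w], and
    [a] the projection of [w + c] to the zonotope [\sum_h [-1, 1] h], the point
    [y = w + c - a] has [a] as a subgradient of [A], so that
    [J y + |w - y|^2 <= J w], and [y = w] only if [w] is an eigenfunction. As
    [c] cannot depend continuously on [w], the pair [(w, c)] is obtained from a
    soft threshold of the given point. *)

Set Implicit Arguments.
Unset Strict Implicit.
Unset Printing Implicit Defensive.

Import Order.TTheory GRing.Theory Num.Theory.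
Import numFieldNormedType.Exports.

Local Open Scope classical_set_scope.
Local Open Scope ring_scope.

(** * Subgradients of [|.|^p / p] *)

Section ScalarConvexity.
Variable R : realType.
Implicit Types p t u z a b s : R.

(* [z] is a subgradient of [|.|^p / p] at [t]. *)
Definition psub p t z : Prop :=
  if p == 1 then `|z| <= 1 /\ z * t = `|t| else z = signed_pow p t.

Lemma SgnP t z : Sgn t z <-> `|z| <= 1 /\ z * t = `|t|.
Proof.
rewrite /Sgn; have [->|t0] := eqVneq t 0.
  by rewrite /= in_itv /= ler_norml mulr0 normr0; split=> [|[]].
rewrite /=; split=> [->|[_ zt]]; first by rewrite normr_sg t0 -normrEsg.
by apply: (mulIf t0); rewrite zt normrEsg.
Qed.

Lemma signed_powN p t : signed_pow p (- t) = - signed_pow p t.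
Proof. by rewrite /signed_pow normrN mulrN. Qed.

Lemma signed_pow_mul p t : 1 < p -> signed_pow p t * t = `|t| `^ p.
Proof.
move=> p1; rewrite /signed_pow -mulrA -[t * t]/(t ^+ 2) -[t ^+ 2]real_normK ?num_real//.
have [->|t0] := eqVneq t 0.
  by rewrite normr0 expr0n /= mulr0 powR0// gt_eqF//; lra.
rewrite -powR_mulrn// -powRD ?normr_eq0 ?t0 ?implybT//.
by congr (_ `^ _); lra.
Qed.

Lemma norm_signed_pow p t : 1 < p -> `|signed_pow p t| = `|t| `^ (p - 1).
Proof.
move=> p1; rewrite /signed_pow normrM ger0_norm ?powR_ge0//.
have [->|t0] := eqVneq t 0.
  by rewrite normr0 mulr0 powR0// gt_eqF//; lra.
rewrite -[X in _ * X]powRr1// -powRD ?normr_eq0 ?t0 ?implybT//.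
by congr (_ `^ _); lra.
Qed.

Lemma psub_mul p t z : 1 <= p -> psub p t z -> z * t = `|t| `^ p.
Proof.
move=> p1; rewrite /psub; case: eqP => [->|p_neq1 ->].
  by move=> [_ ->]; rewrite powRr1.
by rewrite signed_pow_mul// lt_neqAle p1 andbT eq_sym; exact/eqP.
Qed.

Lemma psubN p t z : psub p t z -> psub p (- t) (- z).
Proof.
rewrite /psub; case: eqP => [_ [z1 zt]|_ ->]; last by rewrite signed_powN.
by rewrite mulrNN !normrN.
Qed.

Lemma psub_ex p t : exists z, psub p t z.
Proof.
rewrite /psub; case: eqP => _; last by exists (signed_pow p t).
exists (Num.sg t); rewrite -normrEsg normr_sg; split=> //.
by case: (t != 0).
Qed.

Lemma psub_ge0 p t z : 1 <= p -> 0 < t -> psub p t z -> 0 <= z.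
Proof. by move=> p1 t0 /(psub_mul p1) zt; rewrite -(pmulr_lge0 _ t0) zt powR_ge0. Qed.

(** For [p = 1] this is [|z| <= 1]; for [p > 1] it is Young's inequality with exponents
    [p / (p - 1)] and [p], applied to [|t|^(p - 1)] and [|u|]. *)
Lemma psub_tangent p t z u : 1 <= p -> psub p t z ->
  `|t| `^ p + p * (z * (u - t)) <= `|u| `^ p.
Proof.
move=> p1 zt; rewrite mulrBr (psub_mul p1 zt).
move: zt; rewrite /psub; case: eqP => [->|p_neq1 zE].
  move=> [z1 _]; rewrite !powRr1// mul1r addrC subrK.
  by rewrite (le_trans (ler_norm _))// normrM ler_piMl.
have {}p1 : 1 < p by rewrite lt_neqAle p1 andbT eq_sym; exact/eqP.
have p0 : 0 < p by lra.
have pp0 : 0 < p - 1 by lra.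
have q0 : 0 < p / (p - 1) by rewrite divr_gt0.
have : `|t| `^ (p - 1) * `|u| <= (`|t| `^ (p - 1)) `^ (p / (p - 1)) / (p / (p - 1))
      + `|u| `^ p / p.
  apply: conjugate_powR => //; rewrite ?powR_ge0//.
  by field; rewrite !gt_eqF.
have qE : (p - 1) * (p / (p - 1)) = p by field; rewrite gt_eqF.
rewrite -powRrM qE.
have : z * u <= `|t| `^ (p - 1) * `|u|.
  by rewrite (le_trans (ler_norm _))// normrM zE norm_signed_pow.
move=> h1 h2; have {h1 h2} := le_trans h1 h2.
rewrite -(ler_pM2l p0) mulrDr [p * (_ / p)]mulrC divfK ?gt_eqF//.
have -> : p * (`|t| `^ p / (p / (p - 1))) = (p - 1) * `|t| `^ p.
  by field; rewrite !gt_eqF.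
lra.
Qed.

Lemma psub_monotone p t z u w : 1 <= p -> psub p t z -> psub p u w ->
  0 <= (z - w) * (t - u).
Proof.
move=> p1 zt wu; have := psub_tangent u p1 zt; have := psub_tangent t p1 wu.
have p0 : 0 < p by lra.
by rewrite -(pmulr_rge0 _ p0); lra.
Qed.

Let two_weights_pos p a b t s z : 1 <= p -> 0 <= b < a -> psub p (a - b) z ->
  z * (a * `|t| `^ p - b * `|s| `^ p) <= `|t * a - s * b| `^ p.
Proof.
move=> p1 /andP[b0 ba] zab; have ab0 : 0 < a - b by lra.
have [w wt] := psub_ex p t.
pose x := (t * a - s * b) / (a - b).
have xE : (a - b) * x = t * a - s * b by rewrite mulrC divfK ?gt_eqF.
have hx := psub_tangent x p1 wt; have hs := psub_tangent s p1 wt.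
(* Tangent inequalities at [t] for [x] and [s], with weights [a - b] and [b]; the linear terms
   cancel because [(a - b) x + b s = a t]. *)
have hxs : a * `|t| `^ p <= (a - b) * `|x| `^ p + b * `|s| `^ p.
  have := lerD (ler_wpM2l (ltW ab0) hx) (ler_wpM2l b0 hs).
  suff -> : (a - b) * (`|t| `^ p + p * (w * (x - t))) +
    b * (`|t| `^ p + p * (w * (s - t))) =
    a * `|t| `^ p + p * w * ((a - b) * x - (t * a - s * b)).
    by rewrite xE subrr mulr0 addr0.
  by ring.
have z0 := psub_ge0 p1 ab0 zab.
have -> : `|t * a - s * b| `^ p = z * ((a - b) * `|x| `^ p).
  by rewrite -xE normrM powRM// mulrA (psub_mul p1 zab).
by apply: ler_wpM2l => //; lra.
Qed.

(* Convexity of [|.|^p], with [t] as the mean of [s] and [(t a - s b) / (a - b)]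
   for the weights [b / a] and [(a - b) / a]. *)
Lemma psub_two_weights p a b t s z : 1 <= p -> 0 <= a -> 0 <= b ->
  psub p (a - b) z ->
  z * (a * `|t| `^ p - b * `|s| `^ p) <= `|t * a - s * b| `^ p.
Proof.
move=> p1 a0 b0 zab; case: (ltgtP a b) => ab.
- have : psub p (b - a) (- z) by rewrite -opprB; apply: psubN.
  move=> /(@two_weights_pos p b a s t _ p1); rewrite a0 ab => /(_ isT).
  by rewrite distrC mulNr -mulrN opprB.
- by apply: two_weights_pos => //; rewrite b0.
(* Equal weights: for [p > 1] the subgradient [z] at zero vanishes, for [p = 1] the claim is the
   reverse triangle inequality. *)
- rewrite -{}ab in zab *; rewrite -mulrBr -mulrBl.
  move: zab; rewrite /psub subrr; case: eqP => [->|_ ->]; last first.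
    by rewrite /signed_pow mulr0 mul0r powR_ge0.
  move=> [z1 _]; rewrite !powRr1// normrM (ger0_norm a0).
  rewrite mulrCA mulrC ler_wpM2r//.
  by rewrite (le_trans (ler_norm _))// normrM (le_trans (ler_piMl _ z1))// ler_dist_dist.
Qed.

End ScalarConvexity.

(** * Energy and eigenpairs *)

Section Energy.
Variables (R : realType) (n : nat) (G : ohypergraph n) (p : R).
Hypothesis G_inputs : inputs_only G.
Hypothesis deg_gt0 : forall i : 'I_n, (0 < deg G i)%N.
Hypothesis p_ge1 : 1 <= p.
Implicit Types (x y f : 'rV[R]_n) (zh : hyperedge n -> R) (zv : 'I_n -> R).

(** [energy] and [mass] are the numerator and the denominator of [RQ]. *)
Definition energy x : R := \sum_(h in hedges G) `|hpair h x| `^ p.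
Definition mass x : R := \sum_i (deg G i)%:R * `|x 0 i| `^ p.
(** The transpose of the linear map sending [x] to the family of all [hpair h x], since every
    hyperedge has only inputs. *)
Definition divergence zh (i : 'I_n) : R := \sum_(h in hedges G | i \in h.1) zh h.

Lemma hpair_inputs h x : h \in hedges G -> hpair h x = \sum_(i in h.1) x 0 i.
Proof. by move=> hG; rewrite /hpair (G_inputs hG) big_set0 subr0. Qed.

Lemma hpairZ h (c : R) x : hpair h (c *: x) = c * hpair h x.
Proof.
by rewrite /hpair mulrBr !mulr_sumr; congr (_ - _); apply: eq_bigr => i _; rewrite mxE.
Qed.

Lemma hpairN h x : hpair h (- x) = - hpair h x.
Proof. by rewrite -scaleN1r hpairZ mulN1r. Qed.

Lemma hpairB h x y : hpair h (x - y) = hpair h x - hpair h y.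
Proof.
rewrite /hpair.
rewrite (eq_bigr (fun i => x 0 i - y 0 i)); last by move=> i _; rewrite !mxE.
rewrite [X in _ - X](eq_bigr (fun i => x 0 i - y 0 i)); last by move=> i _; rewrite !mxE.
by rewrite !sumrB; ring.
Qed.

Lemma sum_hpair zh x :
  \sum_(h in hedges G) zh h * hpair h x = \sum_i divergence zh i * x 0 i.
Proof.
under eq_bigr => h hG do rewrite hpair_inputs// mulr_sumr.
rewrite (exchange_big_dep xpredT)//=.
by apply: eq_bigr => i _; rewrite /divergence mulr_suml.
Qed.

(** One formulation for all [p >= 1], through subgradients [zv] on vertices and [zh] on hyperedges;
    for [p > 1] these are forced to be the signed powers, and the degree is multiplied out. *)
Lemma eigenpairE lam f : eigenpair G p lam f <->
  f <> 0 /\ exists zv zh,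
    [/\ forall i, psub p (f 0 i) (zv i),
        forall h, h \in hedges G -> psub p (hpair h f) (zh h) &
        forall i, divergence zh i = lam * (deg G i)%:R * zv i].
Proof.
rewrite /eigenpair /psub; case: ifPn => p1; split=> -[f0].
- move=> [zv [zh [hv hh e]]]; split=> //; exists zv, zh; split.
  + by move=> i; apply/SgnP.
  + by move=> h hG; apply/SgnP/hh.
  + move=> i; rewrite -e /divergence [X in _ - X]big1 ?subr0// => h /andP[hG].
    by rewrite (G_inputs hG) inE.
- move=> [zv [zh [hv hh e]]]; split=> //; exists zv, zh; split.
  + by move=> i; apply/SgnP.
  + by move=> h hG; apply/SgnP/hh.
  + move=> i; rewrite -e /divergence [X in _ - X]big1 ?subr0// => h /andP[hG].
    by rewrite (G_inputs hG) inE.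
- move=> e; split=> //; exists (fun i => signed_pow p (f 0 i)).
  exists (fun h => signed_pow p (hpair h f)); split=> // i.
  have := e i; rewrite mxE mulrAC => <-.
  rewrite mulrAC mulVf ?mul1r ?pnatr_eq0 -?lt0n//.
  have hs h : h \in hedges G -> hsupp h = h.1.
    by move=> hG; rewrite /hsupp (G_inputs hG) finset.setU0.
  rewrite /divergence [LHS]big_mkcondr [RHS]big_mkcondr.
  apply: eq_bigr => h hG; rewrite hs// /incidence; case: ifPn => // ih.
  by rewrite ?ih mul1r.
- move=> [zv [zh [hv hh e]]]; split=> // i.
  rewrite mxE -hv; apply: (@mulfI _ (deg G i)%:R).
    by rewrite pnatr_eq0 -lt0n.
  rewrite mulrA mulfV ?mul1r ?pnatr_eq0 -?lt0n// mulrCA mulrA -e.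
  have hs h : h \in hedges G -> hsupp h = h.1.
    by move=> hG; rewrite /hsupp (G_inputs hG) finset.setU0.
  rewrite /divergence [LHS]big_mkcondr [RHS]big_mkcondr.
  apply: eq_bigr => h hG; rewrite hs// /incidence; case: ifPn => // ih.
  by rewrite ?ih mul1r hh.
Qed.

Lemma eigenpairN lam f : eigenpair G p lam f -> eigenpair G p lam (- f).
Proof.
move=> /eigenpairE[f0 [zv [zh [hv hh e]]]]; apply/eigenpairE; split.
  by apply: contra_not f0 => /eqP; rewrite oppr_eq0 => /eqP.
exists (fun i => - zv i), (fun h => - zh h); split.
- by move=> i; rewrite mxE; apply: psubN.
- by move=> h hG; rewrite hpairN; apply: psubN; apply: hh.
- by move=> i; rewrite /divergence sumrN -/(divergence zh i) e mulrN.
Qed.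

Lemma energy_ge0 x : 0 <= energy x.
Proof. by apply: sumr_ge0 => h _; exact: powR_ge0. Qed.

Lemma mass_gt0 x : x <> 0 -> 0 < mass x.
Proof.
move=> x0; have [i xi] : exists i, x 0 i != 0.
  apply: contrapT => /forallNP xE; apply: x0; apply/rowP => i; rewrite mxE.
  by apply/eqP/negPn/negP => xi; exact: (xE i).
rewrite /mass (bigD1 i)//= ltr_wpDr//.
  by apply: sumr_ge0 => j _; rewrite mulr_ge0// powR_ge0.
by rewrite mulr_gt0 ?ltr0n// powR_gt0// normr_gt0.
Qed.

Lemma RQ_le x c : x <> 0 -> (RQ G p x <= c) = (energy x - c * mass x <= 0).
Proof.
by move=> /mass_gt0 m0; rewrite /RQ -/(energy x) -/(mass x) ler_pdivrMr// subr_le0.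
Qed.

Lemma energyZ (c : R) x : energy (c *: x) = `|c| `^ p * energy x.
Proof.
rewrite /energy mulr_sumr; apply: eq_bigr => h _.
by rewrite hpairZ normrM powRM.
Qed.

Lemma massZ (c : R) x : mass (c *: x) = `|c| `^ p * mass x.
Proof.
rewrite /mass mulr_sumr; apply: eq_bigr => i _.
by rewrite mxE normrM powRM// mulrCA.
Qed.

Lemma RQZ (c : R) x : c != 0 -> RQ G p (c *: x) = RQ G p x.
Proof.
move=> c0; rewrite /RQ -![\sum_(h in _) _]/(energy _) -![\sum_i _]/(mass _).
rewrite energyZ massZ -mulf_div divff ?mul1r//.
by rewrite gt_eqF// powR_gt0// normr_gt0.
Qed.

(** Pairing the eigenvalue equation with [f] gives [energy f = lam * mass f]. *)
Lemma eigenvalue_ge0 lam f : eigenpair G p lam f -> 0 <= lam.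
Proof.
move=> /eigenpairE[f0 [zv [zh [hv hh e]]]].
have : energy f = lam * mass f.
  rewrite /energy (eq_bigr (fun h => zh h * hpair h f)); last first.
    by move=> h hG; rewrite (psub_mul p_ge1 (hh h hG)).
  rewrite sum_hpair /mass mulr_sumr; apply: eq_bigr => i _.
  by rewrite e -mulrA (psub_mul p_ge1 (hv i)) mulrA.
by move=> ef; rewrite -(pmulr_lge0 _ (mass_gt0 f0)) -ef energy_ge0.
Qed.

Lemma energy_tangent x y zh :
  (forall h, h \in hedges G -> psub p (hpair h y) (zh h)) ->
  energy y + p * \sum_i divergence zh i * (x - y) 0 i <= energy x.
Proof.
move=> hh; rewrite -sum_hpair mulr_sumr -big_split /=.
by apply: ler_sum => h hG; rewrite hpairB; apply: psub_tangent => //; exact: hh.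
Qed.

Lemma mass_tangent x y zv : (forall i, psub p (x 0 i) (zv i)) ->
  mass x + p * \sum_i (deg G i)%:R * zv i * (y - x) 0 i <= mass y.
Proof.
move=> hv; rewrite mulr_sumr -big_split /=; apply: ler_sum => i _.
rewrite !mxE -mulrA mulrCA -mulrDr ler_wpM2l//.
exact: psub_tangent.
Qed.

(** A step for a difference of convex functions: the energy is linearized at the new point [y], the
    mass at the old point [x], and [lam >= 0] lets both tangent inequalities be added. Both
    deformations rest on it. *)
Lemma energy_mass_decrease lam x y zh zv : 0 <= lam ->
  (forall h, h \in hedges G -> psub p (hpair h y) (zh h)) ->
  (forall i, psub p (x 0 i) (zv i)) ->
  energy y - lam * mass y +
    p * \sum_i (divergence zh i - lam * (deg G i)%:R * zv i) * (x - y) 0 i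
  <= energy x - lam * mass x.
Proof.
move=> lam0 /(energy_tangent x) hA /(mass_tangent y)/(ler_wpM2l lam0) hB.
have -> : \sum_i (divergence zh i - lam * (deg G i)%:R * zv i) * (x - y) 0 i =
  \sum_i divergence zh i * (x - y) 0 i +
  lam * \sum_i (deg G i)%:R * zv i * (y - x) 0 i.
  rewrite mulr_sumr -big_split; apply: eq_bigr => i _ /=.
  by rewrite !mxE; ring.
by move: hA hB; rewrite !mulrDr; lra.
Qed.

(* [x] ranges over the span of the restrictions of [f] to its nodal domains; every
   hyperedge meets at most one positive and one negative domain, with coefficients
   [t] and [s]. *)
Lemma nodal_scaling_energy lam f x (tau : 'I_n -> R) :
  eigenpair G p lam f ->
  (forall i, x 0 i = tau i * f 0 i) ->
  (forall h i j, h \in hedges G -> i \in h.1 -> j \in h.1 ->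
     0 < f 0 i * f 0 j -> tau i = tau j) ->
  0 <= energy x - lam * mass x.
Proof.
move=> /eigenpairE[f0 [zv [zh [hv hh e]]]] xE tauE.
rewrite subr_ge0.
(* The eigenvalue equation tested against [f |tau|^p] turns [lam * mass x] into a sum over
   hyperedges, so that the inequality can be proved edge by edge. *)
have -> : lam * mass x = \sum_(h in hedges G)
    zh h * hpair h (\row_i (f 0 i * `|tau i| `^ p)).
  rewrite sum_hpair /mass mulr_sumr; apply: eq_bigr => i _.
  rewrite e mxE xE normrM powRM// -(psub_mul p_ge1 (hv i)); ring.
apply: ler_sum => h hG.
pose a := \sum_(i in h.1 | 0 < f 0 i) f 0 i.
pose b := \sum_(i in h.1 | f 0 i < 0) (- f 0 i).
have split3 (c : 'I_n -> R) : \sum_(i in h.1) (c i * f 0 i) =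
    \sum_(i in h.1 | 0 < f 0 i) (c i * f 0 i) - \sum_(i in h.1 | f 0 i < 0) (c i * - f 0 i).
  rewrite [X in _ = X - _]big_mkcondr [X in _ = _ - X]big_mkcondr.
  rewrite -sumrB; apply: eq_bigr => i _.
  case: (ltgtP (f 0 i) 0) => [_|_|->]; rewrite ?mulr0 ?subr0 ?sub0r//.
  by rewrite mulrN opprK.
have a0 : 0 <= a by apply: sumr_ge0 => i /andP[_ /ltW].
have b0 : 0 <= b by apply: sumr_ge0 => i /andP[_ /ltW]; rewrite oppr_ge0.
have [t tE] : exists t, forall i, i \in h.1 -> 0 < f 0 i -> tau i = t.
  have [[i [ih fi]]|no] := pselect (exists i, i \in h.1 /\ 0 < f 0 i).
    exists (tau i) => j jh fj; apply: (tauE h) => //; exact: mulr_gt0.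
  by exists 0 => i ih fi; exfalso; apply: no; exists i.
have [s sE] : exists s, forall i, i \in h.1 -> f 0 i < 0 -> tau i = s.
  have [[i [ih fi]]|no] := pselect (exists i, i \in h.1 /\ f 0 i < 0).
    exists (tau i) => j jh fj; apply: (tauE h) => //.
    by rewrite nmulr_rgt0.
  by exists 0 => i ih fi; exfalso; apply: no; exists i.
(* Used with [phi] constant, the identity and [|.|^p]: this gives [hpair h f], [hpair h x] and the
   pairing with the test vector. *)
have sumE (phi : R -> R) :
    \sum_(i in h.1) (phi (tau i) * f 0 i) = phi t * a - phi s * b.
  rewrite split3 /a /b !mulr_sumr; congr (_ - _); apply: eq_bigr => i /andP[ih fi].
    by rewrite (tE i).
  by rewrite (sE i).
have fE : hpair h f = a - b.
  rewrite hpair_inputs//; have := sumE (fun=> 1).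
  by rewrite !mul1r; under eq_bigr do rewrite mul1r.
have xhE : hpair h x = t * a - s * b.
  by rewrite hpair_inputs// -(sumE id); apply: eq_bigr => i _; rewrite xE.
rewrite xhE hpair_inputs//.
under eq_bigr do rewrite mxE mulrC.
rewrite (sumE (fun t => `|t| `^ p)) [_ * a]mulrC [_ * b]mulrC.
by apply: psub_two_weights => //; rewrite -fE; apply: hh.
Qed.

End Energy.

(** * Nodal domains *)

(** Components are counted through a transversal [T]; [rep] sends a vertex to the chosen vertex of
    its component. *)
Lemma hcomponents_representatives n (E : {set hyperedge n}) (A : {set 'I_n}) :
  exists (T : {set 'I_n}) (rep : 'I_n -> 'I_n),
    [/\ #|T| = #|hcomponents E A|, T \subset A,
        {in A, forall i, rep i \in T}, {in T, forall i, rep i = i} &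
        {in A &, forall i j, hadj E i j -> rep i = rep j}].
Proof.
have sym_adj : symmetric (hadj E).
  by move=> i j; apply: eq_existsb => h; rewrite [X in _ && X]andbC.
have eqv : {in A & &, equivalence_rel (connect (hadj E))}.
  apply: in3W => i j k; split=> [|ij]; first exact: connect0.
  apply/idP/idP; last exact: connect_trans.
  by apply: connect_trans; rewrite (sym_connect_sym sym_adj).
have partA := equivalence_partitionP eqv.
set P := equivalence_partition _ A in partA.
have trT := transversalP partA; set T := transversal _ A in trT.
have [/eqP coverP tiP _] := and3P partA.
have inP i : i \in A -> finset.pblock P i \in P.
  by move=> iA; apply: finset.pblock_mem; rewrite coverP.
exists T, (fun i => transversal_repr i T (finset.pblock P i)); split.
- exact: (card_transversal trT).
- exact: (transversal_sub trT).
- by move=> i iA; apply: (repr_mem_transversal trT); apply: inP.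
- by move=> i iT; apply: (finset.pblockK trT).
move=> i j iA jA ij.
have same : finset.pblock P j = finset.pblock P i.
  apply/esym/finset.same_pblock => //.
  by rewrite (pblock_equivalence_partition eqv)//; apply: connect1; rewrite sym_adj.
apply: finset.set1_inj.
rewrite -(setI_transversal_pblock trT _ (inP _ iA)).
by rewrite -(setI_transversal_pblock trT _ (inP _ jA)) same.
Qed.

Section NodalRepresentatives.
Variables (R : realType) (n : nat) (G : ohypergraph n) (f : 'rV[R]_n).

(** [I] collects the vertices that are not the chosen representative of a nodal domain; it will
    index the [n - m] linear forms. Two vertices of one hyperedge where [f] has the same sign lie in
    the same domain, hence share a representative. *)
Lemma nodal_representatives : exists (I : {set 'I_n}) (rep : 'I_n -> 'I_n),
  [/\ (#|I| + (#|pos_nodal_domains G f| + #|neg_nodal_domains G f|) = n)%N,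
      forall i, i \notin I -> f 0 i != 0 /\ rep i = i,
      forall i, f 0 i != 0 -> f 0 (rep i) != 0 &
      forall h i j, h \in hedges G -> i \in h.1 -> j \in h.1 ->
        0 < f 0 i * f 0 j -> rep i = rep j].
Proof.
have [T [rep [cardT TA repT repid repadj]]] :=
  hcomponents_representatives (hrestrict (hedges G) (supp_pos f)) (supp_pos f).
have [T' [rep' [cardT' TA' repT' repid' repadj']]] :=
  hcomponents_representatives (hrestrict (hedges G) (supp_neg f)) (supp_neg f).
have posT i : i \in T -> 0 < f 0 i by move=> /(fintype.subsetP TA); rewrite inE.
have negT i : i \in T' -> f 0 i < 0.
  by move=> /(fintype.subsetP TA'); rewrite inE oppr_gt0.
exists (~: (T :|: T')), (fun i => if 0 < f 0 i then rep i else rep' i); split.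
- rewrite -cardT -cardT' -cardsUI.
  have -> : T :&: T' = finset.set0.
    apply/finset.setP => i; rewrite !inE; apply/negP => /andP[/posT fi /negT].
    by rewrite ltNge (ltW fi).
  by rewrite finset.cards0 addn0 addnC cardsC card_ord.
- move=> i; rewrite inE negbK inE => /orP[iT|iT].
    by rewrite posT// gt_eqF ?posT// repid.
  by rewrite ltNge ltW ?negT//= lt_eqF ?negT// repid'.
- move=> i fi; case: ifPn => [fi0|].
    by rewrite gt_eqF// posT// repT// inE.
  rewrite -leNgt le_eqVlt (negbTE fi)/= => fi0.
  by rewrite lt_eqF// negT// repT'// inE oppr_gt0.
- move=> h i j hG ih jh fij; have fi0 : f 0 i != 0.
    by apply: contraTneq fij => ->; rewrite mul0r ltxx.
  case: ifPn => fi.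
    have fj : 0 < f 0 j by rewrite -(pmulr_rgt0 _ fi).
    rewrite fj; apply: repadj; rewrite ?inE//.
    apply/existsP; exists (h.1 :&: supp_pos f, h.2 :&: supp_pos f).
    rewrite /hsupp !inE /= ih jh fi fj /= andbT.
    by apply/imsetP; exists h.
  have {}fi : f 0 i < 0 by rewrite lt_neqAle fi0 leNgt.
  have fj : f 0 j < 0 by rewrite -(nmulr_rgt0 _ fi).
  rewrite ltNge (ltW fj) /=; apply: repadj'; rewrite ?inE ?oppr_gt0//.
  apply/existsP; exists (h.1 :&: supp_neg f, h.2 :&: supp_neg f).
  rewrite /hsupp !inE /= ih jh !oppr_gt0 fi fj /= andbT.
  by apply/imsetP; exists h.
Qed.

(* Linear forms cutting out the span of the restrictions of [f] to its nodal
   domains; [rep i] represents the domain of [i]. *)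
Definition nodal_form (rep : 'I_n -> 'I_n) (i : 'I_n) (x : 'rV[R]_n) : R :=
  if f 0 i == 0 then x 0 i else x 0 i * f 0 (rep i) - x 0 (rep i) * f 0 i.

Lemma nodal_formN rep i x : nodal_form rep i (- x) = - nodal_form rep i x.
Proof. by rewrite /nodal_form !mxE; case: ifP => // _; ring. Qed.

(** The forms vanish on [I] by assumption and identically for the other vertices, which are their
    own representatives. So [x] is a multiple of [f] on each nodal domain. *)
Lemma nodal_form_energy (p lam : R) (I : {set 'I_n}) rep x :
  inputs_only G -> (forall i, (0 < deg G i)%N) -> 1 <= p ->
  eigenpair G p lam f ->
  (forall i, i \notin I -> f 0 i != 0 /\ rep i = i) ->
  (forall i, f 0 i != 0 -> f 0 (rep i) != 0) ->
  (forall h i j, h \in hedges G -> i \in h.1 -> j \in h.1 ->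
        0 < f 0 i * f 0 j -> rep i = rep j) ->
  (forall i, i \in I -> nodal_form rep i x = 0) ->
  0 <= energy G p x - lam * mass G p x.
Proof.
move=> Gin Gdeg p1 ef repI rep_neq0 rep_adj x0.
(* Where [f i = 0] the quotient, possibly with zero denominator, only occurs multiplied by zero. *)
apply: (@nodal_scaling_energy _ _ _ _ Gin Gdeg p1 _ f _
  (fun i => x 0 (rep i) / f 0 (rep i)) ef); last first.
  by move=> h i j hG ih jh fij; rewrite (rep_adj h i j).
move=> i; have {}x0 : nodal_form rep i x = 0.
  have [/x0//|/repI[fi repi]] := boolP (i \in I).
  by rewrite /nodal_form (negbTE fi) repi subrr.
move: x0; rewrite /nodal_form; case: eqP => [-> ->|/eqP fi]; first by rewrite mulr0.
by move/eqP; rewrite subr_eq0 mulrAC => /eqP <-; rewrite mulfK// rep_neq0.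
Qed.

End NodalRepresentatives.

(** * Continuity *)

Section ContinuityAt.
Variables (R : realType) (T : topologicalType).
Implicit Types (g h : T -> R) (x : T).

Lemma continuous_at_cst (c : R) x : {for x, continuous (fun=> c)}.
Proof. exact: cst_continuous. Qed.

Lemma continuous_at_add g h x : {for x, continuous g} -> {for x, continuous h} ->
  {for x, continuous (fun y => g y + h y)}.
Proof. by move=> gc hc; apply: cvgD. Qed.

Lemma continuous_at_opp g x : {for x, continuous g} ->
  {for x, continuous (fun y => - g y)}.
Proof. by move=> gc; apply: cvgN. Qed.

Lemma continuous_at_mul g h x : {for x, continuous g} -> {for x, continuous h} ->
  {for x, continuous (fun y => g y * h y)}.
Proof. by move=> gc hc; apply: cvgM. Qed.

Lemma continuous_at_inv g x : g x != 0 -> {for x, continuous g} ->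
  {for x, continuous (fun y => (g y)^-1)}.
Proof. by move=> gx gc; apply: cvgV. Qed.

Lemma continuous_at_norm (V : normedModType R) (g : T -> V) x :
  {for x, continuous g} -> {for x, continuous (fun y => `|g y|)}.
Proof. by move=> gc; apply: cvg_norm. Qed.

Lemma continuous_at_sum (J : Type) (r : seq J) (P : pred J) (g : J -> T -> R) x :
  (forall j, {for x, continuous (g j)}) ->
  {for x, continuous (fun y => \sum_(j <- r | P j) g j y)}.
Proof.
by move=> gc; apply: cvg_big => [|j _]; [exact: add_continuous|exact: gc].
Qed.

Lemma continuous_at_max g h x : {for x, continuous g} -> {for x, continuous h} ->
  {for x, continuous (fun y => Num.max (g y) (h y))}.
Proof.
move=> gc hc; rewrite /prop_for.
under [fun y => Num.max _ _]funext do rewrite maxr_absE.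
apply: cvgM; last exact: cvg_cst.
by apply: cvgD; [exact: cvgD|apply: cvg_norm; exact: cvgB].
Qed.

Lemma continuous_at_min g h x : {for x, continuous g} -> {for x, continuous h} ->
  {for x, continuous (fun y => Num.min (g y) (h y))}.
Proof.
move=> gc hc; rewrite /prop_for.
under [fun y => Num.min _ _]funext do rewrite minr_absE.
apply: cvgM; last exact: cvg_cst.
by apply: cvgB; [exact: cvgD|apply: cvg_norm; exact: cvgB].
Qed.

Lemma continuous_at_comp (U : topologicalType) (k : U -> R) (g : T -> U) x :
  continuous k -> {for x, continuous g} -> {for x, continuous (fun y => k (g y))}.
Proof. by move=> kc gc; apply: (continuous_comp gc); exact: kc. Qed.

Lemma continuous_at_pair (U V : topologicalType) (g : T -> U) (h : T -> V) x :
  {for x, continuous g} -> {for x, continuous h} ->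
  {for x, continuous (fun y => (g y, h y))}.
Proof. by move=> gc hc; apply: cvg_pair. Qed.

Lemma continuous_at_dist g x :
  (forall e, 0 < e -> \forall y \near x, `|g x - g y| < e) ->
  {for x, continuous g}.
Proof. by move=> gx; apply/cvgrPdist_lt. Qed.

Lemma continuous_at_row N (g : T -> 'rV[R]_N) x :
  (forall j, {for x, continuous (fun y => g y 0 j)}) -> {for x, continuous g}.
Proof.
move=> gc A [P nP sPA]; apply: (@filterS _ (nbhs x) _ _ _ (fun y => sPA (g y))).
apply: filter_forall => i; apply: filter_forall => j.
by rewrite (ord1 i); apply: (gc j); have := nP i j; rewrite (ord1 i).
Qed.

Lemma eq_continuous_at (U : topologicalType) (g h : T -> U) x :
  g =1 h -> {for x, continuous g} -> {for x, continuous h}.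
Proof. by move=> /funext ->. Qed.

Lemma continuous_at_mkrow N (g : 'I_N -> T -> R) x :
  (forall j, {for x, continuous (g j)}) ->
  {for x, continuous (fun y => \row_j g j y)}.
Proof.
move=> gc; apply: continuous_at_row => j.
by apply: (@eq_continuous_at _ (g j)) => // y; rewrite mxE.
Qed.

Lemma continuous_at_addv N (g h : T -> 'rV[R]_N) x :
  {for x, continuous g} -> {for x, continuous h} ->
  {for x, continuous (fun y => g y + h y)}.
Proof. by move=> gc hc; apply: cvgD. Qed.

Lemma continuous_at_subv N (g h : T -> 'rV[R]_N) x :
  {for x, continuous g} -> {for x, continuous h} ->
  {for x, continuous (fun y => g y - h y)}.
Proof. by move=> gc hc; apply: cvgB. Qed.

Lemma continuous_at_scale N (k : T -> R) (g : T -> 'rV[R]_N) x :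
  {for x, continuous k} -> {for x, continuous g} ->
  {for x, continuous (fun y => k y *: g y)}.
Proof. by move=> kc gc; apply: cvgZ. Qed.

Lemma continuous_at_sqr g x : {for x, continuous g} ->
  {for x, continuous (fun y => g y ^+ 2)}.
Proof. by move=> gc; apply: cvgM. Qed.

Lemma continuous_at_coord N (g : T -> 'rV[R]_N) j x :
  {for x, continuous g} -> {for x, continuous (fun y => g y 0 j)}.
Proof.
by move=> gc; apply: (@continuous_comp _ _ _ g (fun M : 'rV[R]_N => M 0 j) x gc);
  exact: coord_continuous.
Qed.

End ContinuityAt.

(** * Continuity of powers *)

Section PowerContinuity.
Variable R : realType.

(** Away from zero the power is [expR (q * ln |u|)], whatever the sign of [q]; the exponent [p - 2]
    may be negative. *)
Lemma continuous_norm_powR_neq0 (q t : R) : t != 0 ->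
  {for t, continuous (fun u : R => `|u| `^ q)}.
Proof.
move=> t0; have : {for t, continuous (fun u : R => expR (q * ln `|u|))}.
  apply: (@continuous_comp _ _ _ (fun u : R => q * ln `|u|) expR); last exact: continuous_expR.
  apply: continuous_at_mul; first exact: cst_continuous.
  apply: (@continuous_comp _ _ _ (fun u : R => `|u|) (@ln R)).
    exact: norm_continuous.
  by apply: continuous_ln; rewrite normr_gt0.
rewrite /prop_for /continuous_at /powR normr_eq0 (negbTE t0).
apply: cvg_trans; apply: near_eq_cvg.
have : \forall u \near t, u != 0 by apply: open_nbhs_nbhs; split=> //; exact: open_neq.
by apply: filterS => u u0; rewrite normr_eq0 (negbTE u0).
Qed.

Lemma continuous_norm_powR (q : R) : 0 < q -> continuous (fun u : R => `|u| `^ q).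
Proof.
move=> q0 t; have [->|t0] := eqVneq t 0; last exact: continuous_norm_powR_neq0.
rewrite /prop_for /continuous_at normr0 powR0 ?gt_eqF//.
apply/cvgrPdist_lt => e e0; near=> u.
rewrite sub0r normrN ger0_norm ?powR_ge0//.
have -> : e = (e `^ q^-1) `^ q by rewrite -powRrM mulVf ?gt_eqF// powRr1// ltW.
rewrite gt0_ltr_powR ?nnegrE ?powR_ge0//.
near: u. apply: (@nbhs0_lt _ R^o). exact: powR_gt0.
Unshelve. all: by end_near. Qed.

(** At zero the factor [|t|^(q - 2)] may blow up, so continuity there comes from
    [|signed_pow q t| = |t|^(q - 1)]. *)
Lemma continuous_signed_pow (q : R) : 1 < q -> continuous (signed_pow q).
Proof.
move=> q1 t; have [->|t0] := eqVneq t 0; last first.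
  apply: (@continuous_at_mul _ _ (fun u : R => `|u| `^ (q - 2)) id); last exact: cvg_id.
  exact: continuous_norm_powR_neq0.
have c0 : {for 0, continuous (fun u : R => `|u| `^ (q - 1))}.
  by apply: continuous_norm_powR; rewrite subr_gt0.
rewrite /prop_for /continuous_at {2}/signed_pow mulr0; apply: norm_cvg0.
under eq_fun do rewrite norm_signed_pow//.
by move: c0; rewrite /prop_for /continuous_at normr0 powR0// gt_eqF// subr_gt0.
Qed.

End PowerContinuity.

(** * Genus *)

Section GenusBounds.
Variables (R : realType) (n : nat).
Implicit Types S : set 'rV[R]_n.

Lemma sum_sqr_gt0 N (y : 'rV[R]_N) : y <> 0 -> 0 < \sum_i y 0 i ^+ 2.
Proof.
move=> y0; have s0 : 0 <= \sum_i y 0 i ^+ 2 by apply: sumr_ge0 => i _; exact: sqr_ge0.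
rewrite lt_neqAle s0 andbT eq_sym; apply/eqP => s00; apply: y0.
apply/rowP => i; rewrite mxE; apply/eqP; rewrite -sqrf_eq0.
by rewrite (psumr_eq0P _ s00)// => j _; exact: sqr_ge0.
Qed.

Lemma nonzero_odd_map_to_sphere S N (F : 'rV[R]_n -> 'rV[R]_N) :
  (forall x, (S `\ 0) x -> {for x, continuous F}) ->
  (forall x, (S `\ 0) x -> F x <> 0) ->
  (forall x, (S `\ 0) x -> F (- x) = - F x) ->
  odd_map_to_sphere S N.
Proof.
move=> Fc F0 Fodd.
(* [unit_sphere] is Euclidean while the norm on row vectors is the maximum norm, hence a separate
   normalization. *)
pose nrm (y : 'rV[R]_N) : R := Num.sqrt (\sum_i y 0 i ^+ 2).
have nrm_gt0 y : y <> 0 -> 0 < nrm y.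
  by move=> y0; rewrite sqrtr_gt0; exact: sum_sqr_gt0.
exists (fun x => (nrm (F x))^-1 *: F x); split.
- rewrite continuous_subspace_in => x; rewrite inE => Sx.
  apply: continuous_subspaceT_for => //.
  apply: continuous_at_scale; last exact: Fc.
  apply: continuous_at_inv; first by rewrite gt_eqF// nrm_gt0//; exact: F0.
  apply: (@continuous_at_comp _ _ _ Num.sqrt (fun y => \sum_i F y 0 i ^+ 2)).
    exact: sqrt_continuous.
  apply: continuous_at_sum => i.
  by apply: continuous_at_sqr; apply: continuous_at_coord; exact: Fc.
- move=> x /F0 Fx; rewrite /unit_sphere /=.
  under eq_bigr do rewrite mxE exprMn.
  rewrite -mulr_sumr exprVn sqr_sqrtr ?mulVf ?gt_eqF ?sum_sqr_gt0//.
  exact/ltW/sum_sqr_gt0.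
- move=> x Sx; rewrite Fodd// scalerN; congr (- (_ *: _)).
  congr (Num.sqrt _)^-1; apply: eq_bigr => i _.
  by rewrite mxE sqrrN.
Qed.

(** The identity has no zero on the nonzero points of [S], so a least dimension exists and the
    default value in [genus] is not reached. *)
Lemma is_least_dim_genus S x : (S `\ 0) x -> is_least_dim S (genus S).
Proof.
move=> Sx; rewrite /genus; case: asboolP => [S0|_].
  by exfalso; move: Sx; rewrite S0.
have n_gt0 : (0 < n)%N.
  rewrite lt0n; apply/negP => /eqP n0; apply: Sx.2; apply/rowP => i.
  by have := ltn_ord i; rewrite [X in (_ < X)%N]n0.
have idS : odd_map_to_sphere S n.
  apply: (@nonzero_odd_map_to_sphere _ _ id) => // [y _|y [_ y0]//].
  exact: cvg_id.
pose Q j := `[< (1 <= j)%N /\ odd_map_to_sphere S j >].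
have exQ : exists j, Q j by exists n; apply/asboolP.
have [k kQ kmin] := ex_minnP exQ; move/asboolP: kQ => [k1 kS].
apply: (@xgetPex _ 0%N [set j | is_least_dim S j]); exists k; split=> // j j1 jS.
by apply: kmin; apply/asboolP.
Qed.

Lemma genus_leq S x N : (S `\ 0) x -> (0 < N)%N -> odd_map_to_sphere S N ->
  (genus S <= N)%N.
Proof. by move=> /is_least_dim_genus[_ _ /(_ N)]. Qed.

End GenusBounds.

(** * The unit sphere of the maximum norm *)

Section Normalization.
Variables (R : realType) (n : nat).
Implicit Types x : 'rV[R]_n.

Lemma normalize_neq0 x : x <> 0 -> `|x|^-1 != 0.
Proof. by move/eqP => x0; rewrite invr_eq0 normr_eq0. Qed.

Lemma norm_normalize x : x <> 0 -> `| `|x|^-1 *: x| = 1.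
Proof.
by move/eqP => x0; rewrite normrZ normfV normr_id mulVf// normr_eq0.
Qed.

Lemma norm1_neq0 x : `|x| = 1 -> x <> 0.
Proof. by move=> x1 x0; move: x1; rewrite x0 normr0 => /eqP; rewrite eq_sym oner_eq0. Qed.

Lemma sphere_compact : compact [set x : 'rV[R]_n | `|x| = 1].
Proof.
apply: bounded_closed_compact.
  by exists 1; split; [exact: num_real|move=> M M1 x /= ->; exact: ltW].
apply: (@closed_comp _ _ (fun x : 'rV[R]_n => `|x|) [set 1]).
  by move=> x _; exact: norm_continuous.
exact: closed_eq.
Qed.

End Normalization.

(** As [mu] exceeds the infimum, some set of genus at least [k] has [RQ < mu] on it. Normalizing its
    points, which preserves [RQ], and applying [F] yields an odd map to [R^N] without zeros. *)
Lemma minmax_leq (R : realType) n (G : ohypergraph n) (p lam mu : R) k N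
    (F : 'rV[R]_n -> 'rV[R]_N) :
  (forall i, (0 < deg G i)%N) -> (0 < k)%N ->
  minmax_eigenvalue G p k = lam%:E -> lam < mu ->
  continuous F -> (forall x, F (- x) = - F x) ->
  (forall x, `|x| = 1 -> RQ G p x < mu -> F x <> 0) ->
  (k <= N)%N.
Proof.
move=> Gdeg k0 minE lam_mu Fc Fodd F0.
have : (minmax_eigenvalue G p k < mu%:E)%E by rewrite minE lte_fin.
move=> /ereal_inf_lt[_ [S [Ssym kS] <-] supS].
have RQS x : (S `\ 0) x -> RQ G p x < mu.
  move=> Sx; rewrite -lte_fin (le_lt_trans _ supS)//.
  by apply: ereal_sup_ubound; exists x.
have FS x : (S `\ 0) x -> F (`|x|^-1 *: x) <> 0.
  move=> Sx; have x0 := Sx.2; apply: F0; first exact: norm_normalize.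
  by rewrite RQZ ?normalize_neq0//; exact: RQS.
(* Since [k >= 1], the genus is positive and the set has a nonzero point. *)
have [x Sx] : exists x, (S `\ 0) x.
  move: kS; rewrite /genus; case: asboolP => [_|/eqP/set0P//].
  by rewrite leqn0 gtn_eqF.
have N0 : (0 < N)%N.
  rewrite lt0n; apply/negP => /eqP N0; apply: (FS x Sx); apply/rowP => i.
  by have := ltn_ord i; rewrite [X in (_ < X)%N]N0.
apply: (leq_trans kS); apply: (genus_leq Sx N0).
apply: (@nonzero_odd_map_to_sphere _ _ _ _ (fun x => F (`|x|^-1 *: x))) => //.
- move=> y [_ y0]; apply: (@continuous_comp _ _ _ (fun x => `|x|^-1 *: x) F); last exact: Fc.
  apply: continuous_at_scale; last exact: cvg_id.
  apply: continuous_at_inv; first by rewrite normr_eq0; exact/eqP.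
  exact: norm_continuous.
- by move=> y _; rewrite normrN scalerN Fodd.
Qed.

(* Tietze's theorem, followed by antisymmetrization. *)
Lemma odd_extension (R : realType) n r (E S : set 'rV[R]_n) :
  closed E -> E `<=` S `\ 0 -> centrally_symmetric E ->
  odd_map_to_sphere S r ->
  exists Psi : 'rV[R]_n -> 'rV[R]_r,
    [/\ continuous Psi, forall x, Psi (- x) = - Psi x &
        forall x, E x -> Psi x <> 0].
Proof.
move=> clE ES symE [g [gc gS godd]].
have ext j : exists e : 'rV[R]_n -> R,
    (forall x, E x -> e x = g x 0 j) /\ continuous e.
  have gjc : {within E, continuous (fun x => g x 0 j : R^o)}.
    have gEc := continuous_subspaceW ES gc.
    by move=> x; apply: continuous_at_coord; exact: gEc.
  have gj1 x : E x -> `|g x 0 j| <= 1.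
    move=> /ES/gS; rewrite /unit_sphere /= => g1.
    rewrite -(@ler_pXn2r _ 2) ?nnegrE// expr1n real_normK ?num_real// -g1.
    rewrite (bigD1 j)//= lerDl; apply: sumr_ge0 => i _; exact: sqr_ge0.
  have [e [eE ec _]] := continuous_bounded_extension pseudometric_normal clE ltr01 gjc gj1.
  by exists e; split=> // x Ex; rewrite eE// inE.
have [e eP] := choice ext.
exists (fun x => \row_j (e j x - e j (- x))); split.
- move=> x; apply: continuous_at_mkrow => j.
  have ec := (eP j).2; apply: continuous_at_add; first exact: ec.
  apply: continuous_at_opp; apply: (@continuous_at_comp _ _ _ (e j) (fun y : 'rV[R]_n => - y) _ ec).
  exact: opp_continuous.
- by move=> x; apply/rowP => j; rewrite !mxE opprK opprB.
- move=> x Ex Psi0.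
  (* On [E] the antisymmetrized map equals [2 g], and [g] has unit norm there. *)
  have gx : g x = 0.
    apply/rowP => j; move/rowP: Psi0 => /(_ j); rewrite !mxE.
    rewrite (eP j).1// (eP j).1; last exact: symE.
    rewrite godd; last exact: ES.
    by rewrite mxE opprK => /eqP; rewrite -mulr2n mulrn_eq0 /= => /eqP.
  have := gS _ (ES _ Ex); rewrite /unit_sphere /= gx big1 => [/eqP|i _].
    by rewrite eq_sym oner_eq0.
  by rewrite mxE expr0n.
Qed.

(** * Deformation for [p > 1] *)

Section CompactZeroSets.
Variables (R : realType) (T : topologicalType).

Lemma closed_zeros (g : T -> R) : continuous g -> closed [set x | g x = 0].
Proof.
by move=> gc; apply: (@closed_comp _ _ g [set 0]) => [x _|]; [exact: gc|exact: closed_eq].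
Qed.

(** Turns a strict pointwise bound into a uniform one: [mu] is the minimum of [g], or any number
    above [c] if [Z] is empty. *)
Lemma compact_gap (Z : set T) (g : T -> R) (c : R) : compact Z ->
  (forall x, Z x -> {for x, continuous g}) -> (forall x, Z x -> c < g x) ->
  exists2 mu, c < mu & forall x, Z x -> mu <= g x.
Proof.
move=> Zc gc cg; have [->|/set0P Z0] := eqVneq Z set0.
  by exists (c + 1) => //; rewrite ltrDl.
have gcZ : {within Z, continuous g}.
  rewrite continuous_subspace_in => x; rewrite inE => Zx.
  by apply: continuous_subspaceT_for => //; exact: gc.
have [x Zx xmin] := compact_EVT_min Z0 Zc gcZ.
exists (g x); first by apply: cg; move: Zx; rewrite inE.
by move=> y Zy; apply: xmin; rewrite inE.
Qed.

(** Tube lemma: positivity at parameter zero spreads to a neighbourhood of each [(x, 0)], uniformly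
    by compactness. *)
Lemma compact_small_parameter (Z : set T) (g : T * R -> R) : compact Z ->
  (forall x, Z x -> {for (x, 0), continuous g}) ->
  (forall x, Z x -> 0 < g (x, 0)) ->
  exists2 e, 0 < e & forall s, 0 < s < e -> forall x, Z x -> 0 < g (x, s).
Proof.
move=> /compact_near_coveringP Zc gc g0.
have : \forall s \near (0 : R), Z `<=` (fun x => 0 < g (x, s)).
  apply: (Zc R (nbhs (0 : R)) (fun s x => 0 < g (x, s)) (nbhs_filter _)) => x Zx.
  have : \forall q \near ((x, 0) : T * R), 0 < g q.
    exact: (cvgr_gt (g (x, 0)) (gc x Zx) _ (g0 x Zx)).
  by apply: filterS => -[].
move=> /nbhs_ballP[e /= e0 he]; exists e => // s /andP[s0 se] x Zx.
by apply: (he s) => //; rewrite /ball /= sub0r normrN gtr0_norm.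
Qed.

End CompactZeroSets.

(** * Continuity of energy, mass and Rayleigh quotient *)

Section EnergyContinuity.
Variables (R : realType) (n : nat) (G : ohypergraph n) (T : topologicalType).
Implicit Types (g : T -> 'rV[R]_n) (x : T).

Lemma continuous_at_hpair g h x : {for x, continuous g} ->
  {for x, continuous (fun y => hpair h (g y))}.
Proof.
move=> gc; apply: continuous_at_add; first by
  apply: continuous_at_sum => i; exact: continuous_at_coord.
by apply: continuous_at_opp; apply: continuous_at_sum => i; exact: continuous_at_coord.
Qed.

Lemma continuous_at_energy p g x : 0 < p -> {for x, continuous g} ->
  {for x, continuous (fun y => energy G p (g y))}.
Proof.
move=> p0 gc; apply: continuous_at_sum => h.
apply: (@continuous_at_comp _ _ _ (fun u : R => `|u| `^ p)).
  exact: continuous_norm_powR.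
exact: continuous_at_hpair.
Qed.

Lemma continuous_at_mass p g x : 0 < p -> {for x, continuous g} ->
  {for x, continuous (fun y => mass G p (g y))}.
Proof.
move=> p0 gc; apply: continuous_at_sum => i.
apply: continuous_at_mul; first exact: continuous_at_cst.
apply: (@continuous_at_comp _ _ _ (fun u : R => `|u| `^ p)).
  exact: continuous_norm_powR.
exact: continuous_at_coord.
Qed.

Lemma continuous_at_RQ p g x : (forall i, (0 < deg G i)%N) -> 0 < p ->
  g x <> 0 -> {for x, continuous g} ->
  {for x, continuous (fun y => RQ G p (g y))}.
Proof.
move=> Gdeg p0 gx gc; apply: continuous_at_mul; first exact: continuous_at_energy.
apply: continuous_at_inv; last exact: continuous_at_mass.
by rewrite gt_eqF//; exact: mass_gt0.
Qed.

Lemma continuous_at_divergence (z : T -> hyperedge n -> R) i x :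
  (forall h, {for x, continuous (z^~ h)}) ->
  {for x, continuous (fun y => divergence G (z y) i)}.
Proof. by move=> zc; apply: continuous_at_sum. Qed.

Lemma continuous_at_row_mx N M (g : T -> 'rV[R]_N) (h : T -> 'rV[R]_M) x :
  {for x, continuous g} -> {for x, continuous h} ->
  {for x, continuous (fun y => row_mx (g y) (h y))}.
Proof.
move=> gc hc; apply: continuous_at_row => j; case: (split_ordP j) => k ->.
  apply: (@eq_continuous_at _ _ (fun y => g y 0 k)); last exact: continuous_at_coord.
  by move=> y; rewrite row_mxEl.
apply: (@eq_continuous_at _ _ (fun y => h y 0 k)); last exact: continuous_at_coord.
by move=> y; rewrite row_mxEr.
Qed.

Lemma row_mx_eq0P N M (a : 'rV[R]_N) (b : 'rV[R]_M) :
  row_mx a b = 0 -> a = 0 /\ b = 0.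
Proof. by move/eqP; rewrite row_mx_eq0 => /andP[/eqP-> /eqP->]. Qed.

End EnergyContinuity.

(** * The explicit gradient step *)

Section SmoothDeformation.
Variables (R : realType) (n : nat) (G : ohypergraph n) (p lam : R).
Hypothesis G_inputs : inputs_only G.
Hypothesis deg_gt0 : forall i : 'I_n, (0 < deg G i)%N.
Hypothesis p_gt1 : 1 < p.
Hypothesis lam_ge0 : 0 <= lam.
Implicit Types x y : 'rV[R]_n.

Let p_ge1 : 1 <= p. Proof. exact: ltW. Qed.

Let psubE t z : psub p t z <-> z = signed_pow p t.
Proof. by rewrite /psub gt_eqF. Qed.

(** Up to the factor [p], [hgrad] and [vgrad] are the gradients of [energy] and of [lam * mass].
    They are kept apart because the descent estimate evaluates them at different points. *)
Definition hgrad x (i : 'I_n) : R :=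
  divergence G (fun h => signed_pow p (hpair h x)) i.
Definition vgrad x (i : 'I_n) : R := lam * (deg G i)%:R * signed_pow p (x 0 i).
Definition gradient x : 'rV[R]_n := \row_i (hgrad x i - vgrad x i).

Lemma gradient_eigenpair x : x <> 0 -> gradient x = 0 <-> eigenpair G p lam x.
Proof.
move=> x0; split=> [/rowP g0|].
  apply/(eigenpairE p G_inputs deg_gt0); split=> //.
  exists (fun i => signed_pow p (x 0 i)), (fun h => signed_pow p (hpair h x)).
  split=> [i|h _|i]; try exact/psubE.
  by have := g0 i; rewrite !mxE => /eqP; rewrite subr_eq0 => /eqP.
move=> /(eigenpairE p G_inputs deg_gt0)[_ [zv [zh [hv hh e]]]].
apply/rowP => i; rewrite !mxE /vgrad; have /psubE <- := hv i; rewrite -e.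
apply/eqP; rewrite subr_eq0; apply/eqP; apply: eq_bigr => h /andP[hG _].
by apply/esym/psubE/hh.
Qed.

Lemma gradientN x : gradient (- x) = - gradient x.
Proof.
apply/rowP => i; rewrite !mxE opprD /hgrad /vgrad !mxE signed_powN mulrN.
congr (_ + _); rewrite /divergence -sumrN; apply: eq_bigr => h _.
by rewrite hpairN signed_powN.
Qed.

Let continuous_at_hgrad (T : topologicalType) (g : T -> 'rV[R]_n) i t :
  {for t, continuous g} -> {for t, continuous (fun u => hgrad (g u) i)}.
Proof.
move=> gc; apply: continuous_at_divergence => h.
apply: (continuous_at_comp (continuous_signed_pow p_gt1)).
exact: continuous_at_hpair.
Qed.

Let continuous_at_vgrad (T : topologicalType) (g : T -> 'rV[R]_n) i t :
  {for t, continuous g} -> {for t, continuous (fun u => vgrad (g u) i)}.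
Proof.
move=> gc; apply: continuous_at_mul; first exact: continuous_at_cst.
apply: (continuous_at_comp (continuous_signed_pow p_gt1)).
exact: continuous_at_coord.
Qed.

Let continuous_at_gradient (T : topologicalType) (g : T -> 'rV[R]_n) t :
  {for t, continuous g} -> {for t, continuous (fun u => gradient (g u))}.
Proof.
move=> gc; apply: continuous_at_mkrow => i; apply: continuous_at_add.
  exact: continuous_at_hgrad.
by apply: continuous_at_opp; exact: continuous_at_vgrad.
Qed.

Let continuous_gradient : continuous gradient.
Proof. by move=> x; apply: continuous_at_gradient; exact: cvg_id. Qed.

(** Within the unit sphere the eigenfunctions are the zeros of the continuous [gradient]. *)
Lemma closed_eigenpair_gt1 : closed [set x | `|x| = 1 /\ eigenpair G p lam x].
Proof.
have -> : [set x | `|x| = 1 /\ eigenpair G p lam x] =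
    [set x | `|x| = 1] `&` [set x | `|gradient x| = 0].
  apply/seteqP; split=> x /= [x1 ex]; split=> //; have x0 := norm1_neq0 x1.
    by apply/eqP; rewrite normr_eq0; apply/eqP/(gradient_eigenpair x0).
  by apply/(gradient_eigenpair x0)/eqP; rewrite -normr_eq0 ex.
apply: closedI; first exact: (compact_closed (@norm_hausdorff _ _) (@sphere_compact R n)).
apply: closed_zeros => x; apply: continuous_at_norm; exact: continuous_gradient.
Qed.

Variables (r m : nat) (Psi : 'rV[R]_n -> 'rV[R]_r) (L : 'rV[R]_n -> 'rV[R]_m).
Hypothesis Psi_cont : continuous Psi.
Hypothesis Psi_odd : forall x, Psi (- x) = - Psi x.
Hypothesis Psi_neq0 : forall x, `|x| = 1 -> eigenpair G p lam x -> Psi x <> 0.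
Hypothesis L_cont : continuous L.
Hypothesis L_odd : forall x, L (- x) = - L x.
Hypothesis L_energy : forall x, L x = 0 -> 0 <= energy G p x - lam * mass G p x.

(** For [q = (x, s)], the decrease term of [energy_mass_decrease] at [y = x - s * gradient x],
    divided by [p s]; at [s = 0] it is the squared Euclidean norm of the gradient. *)
Let slope (q : 'rV[R]_n * R) : R :=
  \sum_i (hgrad (q.1 - q.2 *: gradient q.1) i - vgrad q.1 i) * gradient q.1 0 i.

Let continuous_slope : continuous slope.
Proof.
move=> q; have c1 : {for q, continuous (fun q : 'rV[R]_n * R => q.1)} by exact: cvg_fst.
have c2 : {for q, continuous (fun q : 'rV[R]_n * R => q.2)} by exact: cvg_snd.
have cg := continuous_at_gradient c1.
apply: continuous_at_sum => i; apply: continuous_at_mul; last exact: continuous_at_coord.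
apply: continuous_at_add; last by apply: continuous_at_opp; exact: continuous_at_vgrad.
apply: continuous_at_hgrad; apply: continuous_at_subv; first exact: c1.
exact: continuous_at_scale.
Qed.

Lemma smooth_deformation : exists mu (F : 'rV[R]_n -> 'rV[R]_(r + m)),
  [/\ lam < mu, continuous F, forall x, F (- x) = - F x &
      forall x, `|x| = 1 -> RQ G p x < mu -> F x <> 0].
Proof.
(* No eigenfunction lies in [Z0], so the gradient has no zero on this compact set and one step size
   works for all its points. *)
pose Z0 := [set x : 'rV[R]_n | `|x| = 1] `&` [set x | `|Psi x| = 0].
have Z0c : compact Z0.
  apply: compact_closedI; first exact: sphere_compact.
  by apply: closed_zeros => x; apply: continuous_at_norm; exact: Psi_cont.
have [e e0 he] : exists2 e, 0 < e &
    forall s, 0 < s < e -> forall x, Z0 x -> 0 < slope (x, s).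
  apply: compact_small_parameter => // [x _|x [/= x1 Psix]]; first exact: continuous_slope.
  have -> : slope (x, 0) = \sum_i gradient x 0 i ^+ 2.
    by apply: eq_bigr => i _; rewrite /= scale0r subr0 expr2 ![gradient x 0 i]mxE.
  apply: sum_sqr_gt0 => /(gradient_eigenpair (norm1_neq0 x1))/(Psi_neq0 x1); apply.
  by apply/eqP; rewrite -normr_eq0 Psix.
pose s := e / 2; have s0 : 0 < s by rewrite divr_gt0.
have se : 0 < s < e by rewrite s0 /s ltr_pdivrMr// ltr_pMr// ltr1n.
pose F x := row_mx (Psi x) (L (x - s *: gradient x)).
have Fc : continuous F.
  move=> x; apply: continuous_at_row_mx; first exact: Psi_cont.
  apply: (@continuous_comp _ _ _ (fun x => x - s *: gradient x) L); last exact: L_cont.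
  apply: continuous_at_subv; first exact: cvg_id.
  apply: continuous_at_scale; first exact: cst_continuous.
  exact: continuous_gradient.
(* At a zero [x] of [F] the step strictly decreases [J], yet ends in the kernel of [L], where
   [J >= 0]; hence [J x > 0]. *)
have F0 x : `|x| = 1 -> F x = 0 -> lam < RQ G p x.
  move=> x1 /row_mx_eq0P[Psi0 L0]; have x0 := norm1_neq0 x1.
  have slope0 : 0 < slope (x, s) by apply: he => //; split=> //=; rewrite Psi0 normr0.
  set y := x - s *: gradient x in L0.
  rewrite ltNge RQ_le// -ltNge; apply: (le_lt_trans (L_energy L0)).
  have := @energy_mass_decrease _ _ _ _ G_inputs p_ge1 lam x y
    (fun h => signed_pow p (hpair h y)) (fun i => signed_pow p (x 0 i)) lam_ge0.
  move=> /(_ (fun _ _ => (psubE _ _).2 erefl) (fun _ => (psubE _ _).2 erefl)).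
  apply: lt_le_trans; rewrite ltrDl mulr_gt0//; first by rewrite (lt_trans ltr01).
  suff -> : \sum_i (divergence G (fun h => signed_pow p (hpair h y)) i -
      lam * (deg G i)%:R * signed_pow p (x 0 i)) * (x - y) 0 i = s * slope (x, s).
    by rewrite mulr_gt0.
  rewrite /slope mulr_sumr; apply: eq_bigr => i _.
  have -> : x - y = s *: gradient x by rewrite /y opprB addrC subrK.
  by rewrite mxE mulrCA.
have [mu lam_mu hmu] : exists2 mu, lam < mu &
    forall x, ([set x | `|x| = 1] `&` [set x | `|F x| = 0]) x -> mu <= RQ G p x.
  apply: compact_gap.
  - apply: compact_closedI; first exact: sphere_compact.
    by apply: closed_zeros => x; apply: continuous_at_norm; exact: Fc.
  - move=> x [/= x1 _]; apply: (@continuous_at_RQ _ _ _ 'rV[R]_n _ id) => //.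
    + by rewrite (lt_trans ltr01).
    + exact: norm1_neq0.
  - by move=> x [/= x1 /eqP]; rewrite normr_eq0 => /eqP; exact: F0.
exists mu, F; split=> //.
- by move=> x; rewrite /F gradientN Psi_odd scalerN -opprD L_odd opp_row_mx.
- move=> x x1 xmu Fx; have := hmu x; rewrite leNgt xmu /= Fx normr0.
  by move=> /(_ (conj x1 erefl)).
Qed.

End SmoothDeformation.

(** * Deformation for [p = 1] *)

Section Resolvent.
Variables (R : realType) (n : nat) (G : ohypergraph n).
Hypothesis G_inputs : inputs_only G.
Implicit Types (x y : 'rV[R]_n) (zh : hyperedge n -> R).

Let div_row zh : 'rV[R]_n := \row_i divergence G zh i.

Lemma psub1E (t z : R) : psub 1 t z <-> `|z| <= 1 /\ z * t = `|t|.
Proof. by rewrite /psub eqxx. Qed.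

Lemma ge0_quadratic_le0 (a b : R) :
  (forall e, 0 < e <= 1 -> 2 * (e * a) <= e ^+ 2 * b) -> a <= 0.
Proof.
move=> ab; rewrite leNgt; apply/negP => a0.
have b0 : 0 <= `|b| by []. have bb := ler_norm b.
have d0 : 0 < a + `|b| by lra.
(* With this [e] one has [e |b| = a - e a < a], contradicting [2 a <= e b]. *)
pose e := a / (a + `|b|); have e0 : 0 < e by rewrite divr_gt0.
have ed : e * (a + `|b|) = a by rewrite divfK// gt_eqF.
have e1 : e <= 1 by rewrite ler_pdivrMr// mul1r; lra.
have := ab e; rewrite e0 e1 => /(_ isT).
rewrite mulrCA expr2 -mulrA ler_pM2l//.
have : e * b <= e * `|b| by rewrite ler_pM2l.
have : 0 < e * a by rewrite mulr_gt0.
by move: ed; rewrite mulrDr; lra.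
Qed.

(* The minimizer of the distance from [x] to the zonotope of the divergences of
   [[-1, 1]]-valued functions on the hyperedges. *)
Lemma resolvent_exists x : exists zh, forall h, h \in hedges G ->
  psub 1 (hpair h (x - div_row zh)) (zh h).
Proof.
(* Weights are coded as row vectors indexed by all possible hyperedges, so that they range over a
   compact cube. *)
pose zh_of (v : 'rV[R]_#|{: hyperedge n}|) h : R := v 0 (enum_rank h).
pose q v : R := \sum_i (x 0 i - divergence G (zh_of v) i) ^+ 2.
pose cube := [set v : 'rV[R]_#|{: hyperedge n}| | forall j, `[(-1 : R), 1]%classic (v ord0 j)].
have cube_compact : compact cube.
  apply: (@rV_compact R _ (fun=> `[(-1 : R), 1]%classic)) => j; exact: segment_compact.
have cube0 : cube !=set0.
  by exists 0 => j; rewrite /= mxE in_itv /=; apply/andP; split; lra.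
have qc : {within cube, continuous q}.
  apply: continuous_subspaceT => v; apply: continuous_at_sum => i.
  apply: continuous_at_sqr; apply: continuous_at_add; first exact: continuous_at_cst.
  apply: continuous_at_opp; apply: continuous_at_divergence => h.
  exact: coord_continuous.
have [v vcube vmin] := compact_EVT_min cube0 cube_compact qc.
move: vcube; rewrite inE => vcube; exists (zh_of v) => h hG.
set y := x - _; set P := hpair h y; set z := zh_of v h.
have z1 : -1 <= z <= 1 by have := vcube (enum_rank h); rewrite /= in_itv.
(* Variational inequality, obtained by moving the weight of [h] from [z] towards [w] inside the
   cube. *)
have key w : -1 <= w <= 1 -> (w - z) * P <= 0.
  move=> w1; apply: (@ge0_quadratic_le0 _ ((w - z) ^+ 2 * #|h.1|%:R)) => e /andP[e0 e1].
  pose d := e * (w - z); pose v' := v + d *: delta_mx 0 (enum_rank h).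
  have v'E h' : zh_of v' h' = zh_of v h' + d * (h' == h)%:R.
    by rewrite /zh_of !mxE eqxx (inj_eq enum_rank_inj).
  have v'cube : v' \in cube.
    rewrite inE => j; rewrite -(enum_valK j); set h' := enum_val j.
    have := v'E h'; rewrite /zh_of => -> /=; rewrite in_itv /=.
    case: eqP => [->|_]; last by rewrite mulr0 addr0; have := vcube (enum_rank h'); rewrite /= in_itv.
    rewrite mulr1 -/(zh_of v h) -/z /d; move: w1 z1 => /andP[w1 w2] /andP[z1 z2].
    apply/andP; split.
      have : 0 <= (1 - e) * (z + 1) + e * (w + 1) by rewrite addr_ge0// mulr_ge0//; lra.
      by lra.
    have : 0 <= (1 - e) * (1 - z) + e * (1 - w) by rewrite addr_ge0// mulr_ge0//; lra.
    by lra.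
  have divE i : divergence G (zh_of v') i = divergence G (zh_of v) i + d * (i \in h.1)%:R.
    rewrite /divergence; under eq_bigr do rewrite v'E.
    rewrite big_split /=; congr (_ + _); rewrite -mulr_sumr; congr (_ * _).
    have [ih|ih] := boolP (i \in h.1).
      rewrite (bigD1 h) /= ?hG// eqxx big1 ?addr0// => h' /andP[_ /negbTE ->] //.
    by rewrite big1// => h' /andP[_ ih']; case: eqP => // hh'; rewrite -hh' ih' in ih.
  have := vmin _ v'cube.
  suff -> : q v' = q v - 2 * (d * P) + d ^+ 2 * #|h.1|%:R.
    by rewrite /d; lra.
  have -> : P = \sum_i y 0 i * (i \in h.1)%:R.
    rewrite /P (hpair_inputs G_inputs)// big_mkcond; apply: eq_bigr => i _.
    by case: (i \in h.1); rewrite ?mulr1 ?mulr0.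
  have -> : (#|h.1|%:R : R) = \sum_i (i \in h.1)%:R.
    by rewrite -sum1_card natr_sum big_mkcond; apply: eq_bigr => i _; case: (i \in h.1).
  rewrite /q !mulr_sumr -sumrN -!big_split; apply: eq_bigr => i _ /=.
  rewrite divE !mxE; case: (i \in h.1); rewrite /=; ring.
apply/psub1E; split; first by rewrite ler_norml.
apply/eqP; rewrite eq_le; apply/andP; split.
  by rewrite (le_trans (ler_norm _))// normrM ler_piMl// ler_norml.
(* Taking the sign of [P] for [w] gives [|P| <= z P]. *)
have : (Num.sg P - z) * P <= 0.
  by apply: key; rewrite -ler_norml normr_sg; case: (P != 0); rewrite /= ?ler01.
by rewrite mulrBl -normrEsg subr_le0.
Qed.

(** The weights need not be unique; only their divergence, the projection of [x], is determined. The
    point [x - resolvent x] is the proximal point of the energy for [p = 1]. *)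
Definition resolvent_weights x : hyperedge n -> R := projT1 (cid (resolvent_exists x)).
Definition resolvent x : 'rV[R]_n := div_row (resolvent_weights x).

Lemma resolvent_weightsP x h : h \in hedges G ->
  psub 1 (hpair h (x - resolvent x)) (resolvent_weights x h).
Proof. by move: h; exact: (projT2 (cid (resolvent_exists x))). Qed.

(** Monotonicity of subgradients makes the inner product of [u - v] and [(x - u) - (y - v)]
    nonnegative; then [|x - y|^2] is expanded. As [zh] is an arbitrary solution at [y], uniqueness
    follows too. *)
Lemma resolvent_nonexpansive x y zh :
  (forall h, h \in hedges G -> psub 1 (hpair h (y - div_row zh)) (zh h)) ->
  \sum_i (resolvent x 0 i - div_row zh 0 i) ^+ 2 <= \sum_i (x 0 i - y 0 i) ^+ 2.
Proof.
move=> zhP; set u := resolvent x; set v := div_row zh.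
have mono : 0 <= \sum_i (u 0 i - v 0 i) * ((x - u) - (y - v)) 0 i.
  pose dz h := resolvent_weights x h - zh h.
  have -> : \sum_i (u 0 i - v 0 i) * ((x - u) - (y - v)) 0 i =
      \sum_i divergence G dz i * ((x - u) - (y - v)) 0 i.
    apply: eq_bigr => i _; congr (_ * _).
    by rewrite !mxE /divergence -sumrB.
  rewrite -(sum_hpair G_inputs); apply: sumr_ge0 => h hG; rewrite hpairB.
  apply: (@psub_monotone _ 1) => //; [exact: resolvent_weightsP|exact: zhP].
rewrite -subr_ge0 -sumrB.
have h2 : 0 <= \sum_i ((x 0 i - y 0 i) - (u 0 i - v 0 i)) ^+ 2.
  by apply: sumr_ge0 => i _; exact: sqr_ge0.
have -> : \sum_i ((x 0 i - y 0 i) ^+ 2 - (u 0 i - v 0 i) ^+ 2) =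
  2 * \sum_i (u 0 i - v 0 i) * ((x - u) - (y - v)) 0 i +
  \sum_i ((x 0 i - y 0 i) - (u 0 i - v 0 i)) ^+ 2.
  rewrite mulr_sumr -big_split; apply: eq_bigr => i _ /=; rewrite [_ 0 i in RHS]mxE.
  by rewrite !mxE; ring.
by lra.
Qed.

Lemma resolvent_unique x zh :
  (forall h, h \in hedges G -> psub 1 (hpair h (x - div_row zh)) (zh h)) ->
  resolvent x = div_row zh.
Proof.
move=> /(@resolvent_nonexpansive x); rewrite [leRHS]big1; last first.
  by move=> i _; rewrite subrr expr0n.
move=> le0; apply/eqP; rewrite -subr_eq0; apply/eqP.
apply: contrapT => /sum_sqr_gt0; apply/negP; rewrite -leNgt.
apply: le_trans le0; rewrite le_eqVlt; apply/orP; left; apply/eqP.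
by apply: eq_bigr => i _; rewrite !mxE.
Qed.

Lemma resolventN x : resolvent (- x) = - resolvent x.
Proof.
have -> : - resolvent x = div_row (fun h => - resolvent_weights x h).
  by apply/rowP => i; rewrite !mxE /divergence sumrN.
apply: resolvent_unique => h hG.
have -> : - x - div_row (fun h => - resolvent_weights x h) = - (x - resolvent x).
  by apply/rowP => i; rewrite !mxE /divergence sumrN; ring.
by rewrite hpairN; apply: psubN; exact: resolvent_weightsP.
Qed.

Lemma continuous_resolvent : continuous resolvent.
Proof.
move=> x; apply: continuous_at_row => j; apply: continuous_at_dist => e e0.
pose N y : R := \sum_i (y 0 i - x 0 i) ^+ 2.
have Nc : {for x, continuous N}.
  apply: continuous_at_sum => i; apply: continuous_at_sqr.
  apply: continuous_at_add; first exact: coord_continuous.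
  exact: continuous_at_cst.
have N0 : N x = 0 by rewrite /N big1// => i _; rewrite subrr expr0n.
have : \forall y \near x, N y < e ^+ 2.
  by apply: (cvgr_lt (N x) Nc); rewrite N0 exprn_gt0.
apply: filterS => y Ny; rewrite distrC.
rewrite -(@ltr_pXn2r _ 2) ?nnegrE ?(ltW e0)//. rewrite real_normK ?num_real//.
apply: le_lt_trans Ny.
apply: (le_trans _ (@resolvent_nonexpansive y x _ (@resolvent_weightsP x))).
rewrite [leRHS](bigD1 j)//= lerDl; apply: sumr_ge0 => i _; exact: sqr_ge0.
Qed.

End Resolvent.

(** * Soft thresholding *)

Section SoftThreshold.
Variable R : realType.
Implicit Types d t : R.

Definition clamp d t : R := Num.max (- d) (Num.min t d).

Lemma clampN d t : 0 <= d -> clamp d (- t) = - clamp d t.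
Proof.
rewrite /clamp => d0; case: (leP t d) => td; case: (leP (- t) d) => ntd;
  rewrite ?maxEle; do ?[case: ifPn]; rewrite -?ltNge; lra.
Qed.

Lemma clamp0 t : clamp 0 t = 0.
Proof. by rewrite /clamp oppr0; case: (leP t 0) => t0; case: (leP 0 _); lra. Qed.

Lemma clamp_bound d t : 0 <= d -> `|clamp d t| <= d.
Proof.
rewrite /clamp ler_norml => d0; case: (leP t d) => td; rewrite maxEle;
  case: ifPn; rewrite -?ltNge; lra.
Qed.

(** With [clamp_bound], [clamp d t / d] is a subgradient of [|.|] at the soft threshold
    [t - clamp d t], and it is continuous in [t]. *)
Lemma clamp_soft d t : 0 < d -> clamp d t / d * (t - clamp d t) = `|t - clamp d t|.
Proof.
move=> d0; have dd : d / d = 1 by rewrite divff// gt_eqF.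
rewrite /clamp; case: (leP t d) => td; rewrite maxEle.
  case: ifPn => ntd; first by rewrite subrr normr0 mulr0.
  rewrite mulNr dd mulN1r opprK ltr0_norm //; move: ntd; rewrite -ltNge; lra.
have -> : - d <= d by lra.
by rewrite dd mul1r gtr0_norm// subr_gt0.
Qed.

End SoftThreshold.

(** * The implicit step *)

Section NonsmoothDeformation.
Variables (R : realType) (n : nat) (G : ohypergraph n) (lam : R).
Hypothesis G_inputs : inputs_only G.
Hypothesis deg_gt0 : forall i : 'I_n, (0 < deg G i)%N.
Hypothesis lam_ge0 : 0 <= lam.
Implicit Types (x y w : 'rV[R]_n) (zv : 'rV[R]_n).

Let res : 'rV[R]_n -> 'rV[R]_n := resolvent G_inputs.
Let vweight zv : 'rV[R]_n := \row_i (lam * (deg G i)%:R * zv 0 i).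
(** For [q = (w, v)] with [v] a vector of signs, [c = vweight v], [arg q = w + c] and
    [a = res (arg q)] are the data of the implicit step. *)
Let arg (q : 'rV[R]_n * 'rV[R]_n) : 'rV[R]_n := q.1 + vweight q.2.

(** Its zeros in [sphere_cube] are the pairs in the graph of the coordinatewise [Sgn], which is
    thereby compact. *)
Let sign_defect (q : 'rV[R]_n * 'rV[R]_n) : R :=
  \sum_i `|q.2 0 i * q.1 0 i - `|q.1 0 i| |.

Let continuous_at_arg (T : topologicalType) (a b : T -> 'rV[R]_n) t :
  {for t, continuous a} -> {for t, continuous b} ->
  {for t, continuous (fun u => arg (a u, b u))}.
Proof.
move=> ac bc; apply: continuous_at_addv => //; apply: continuous_at_mkrow => i.
apply: continuous_at_mul; first exact: continuous_at_cst.
exact: continuous_at_coord.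
Qed.

Let continuous_fst : continuous (fun q : 'rV[R]_n * 'rV[R]_n => q.1).
Proof. by move=> q; exact: cvg_fst. Qed.

Let continuous_snd : continuous (fun q : 'rV[R]_n * 'rV[R]_n => q.2).
Proof. by move=> q; exact: cvg_snd. Qed.

Let continuous_arg : continuous arg.
Proof.
move=> q; apply: (@eq_continuous_at _ _ (fun q => arg (q.1, q.2))) => [[]//|].
by apply: continuous_at_arg; [exact: continuous_fst|exact: continuous_snd].
Qed.

Let continuous_sign_defect : continuous sign_defect.
Proof.
move=> q; apply: continuous_at_sum => i; apply: (@continuous_at_norm _ _ R).
have c1 : {for q, continuous (fun q : 'rV[R]_n * 'rV[R]_n => q.1 0 i)}.
  by apply: continuous_at_coord; exact: continuous_fst.
have c2 : {for q, continuous (fun q : 'rV[R]_n * 'rV[R]_n => q.2 0 i)}.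
  by apply: continuous_at_coord; exact: continuous_snd.
apply: continuous_at_add; first exact: continuous_at_mul.
by apply: continuous_at_opp; exact: (@continuous_at_norm _ _ R).
Qed.

Let sign_defect_eq0 q : sign_defect q = 0 <-> forall i, q.2 0 i * q.1 0 i = `|q.1 0 i|.
Proof.
split=> [sd i|qE].
  apply/eqP; rewrite -subr_eq0 -normr_eq0.
  by rewrite (psumr_eq0P _ sd).
by rewrite /sign_defect big1// => i _; rewrite qE subrr normr0.
Qed.

Let sphere_cube : set ('rV[R]_n * 'rV[R]_n) :=
  [set x : 'rV[R]_n | `|x| = 1] `*`
  [set v : 'rV[R]_n | forall j, `[(-1 : R), 1]%classic (v ord0 j)].

Let compact_sphere_cube : compact sphere_cube.
Proof.
apply: compact_setX; first exact: sphere_compact.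
by apply: (@rV_compact R _ (fun=> `[(-1 : R), 1]%classic)) => j; exact: segment_compact.
Qed.

Let sgn_graph q : sphere_cube q -> sign_defect q = 0 ->
  forall i, psub 1 (q.1 0 i) (q.2 0 i).
Proof.
move=> [_ /= q2] /sign_defect_eq0 qE i; apply/psub1E; split=> //.
by rewrite ler_norml; have := q2 i; rewrite in_itv.
Qed.

(** Here [arg q - res (arg q)] is [q.1], so the resolvent weights are subgradients at [q.1]
    itself. *)
Let fixed_eigenpair q : sphere_cube q -> sign_defect q = 0 ->
  res (arg q) = vweight q.2 -> eigenpair G 1 lam q.1.
Proof.
move=> qK qs rq; apply/(eigenpairE _ G_inputs deg_gt0).
split; first exact: (norm1_neq0 qK.1).
exists (fun i => q.2 0 i), (resolvent_weights G_inputs (arg q)); split.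
- exact: sgn_graph.
- move=> h hG; have := resolvent_weightsP G_inputs (arg q) hG.
  by rewrite -/(res _) rq /arg addrK.
- by move=> i; move/rowP: rq => /(_ i); rewrite !mxE.
Qed.

(** An eigenfunction comes with a choice of signs, so the set is obtained as the projection of a
    compact set of pairs. *)
Lemma closed_eigenpair_1 : closed [set x | `|x| = 1 /\ eigenpair G 1 lam x].
Proof.
pose D := sphere_cube `&` [set q | sign_defect q + `|res (arg q) - vweight q.2| = 0].
have -> : [set x | `|x| = 1 /\ eigenpair G 1 lam x] = (fun q => q.1) @` D.
  apply/seteqP; split=> x /=.
    move=> [x1 /(eigenpairE _ G_inputs deg_gt0)[x0 [zv [zh [hv hh e]]]]].
    exists (x, \row_i zv i) => //; split.
      split=> //= i; rewrite mxE in_itv /= -ler_norml.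
      by have /psub1E[] := hv i.
    rewrite /= [sign_defect _](sign_defect_eq0 _).2 ?add0r; last first.
      by move=> i /=; rewrite mxE; have /psub1E[] := hv i.
    have -> : vweight (\row_i zv i) = \row_i divergence G zh i.
      by apply/rowP => i; rewrite !mxE e.
    (* By uniqueness, the hyperedge subgradients of the eigenpair compute the resolvent. *)
    apply/eqP; rewrite normr_eq0 subr_eq0; apply/eqP; apply: resolvent_unique => h hG.
    rewrite /arg /=; have -> : vweight (\row_i zv i) = \row_i divergence G zh i.
      by apply/rowP => i; rewrite !mxE e.
    by rewrite addrK; exact: hh.
  move=> [q [qK /= /eqP]]; rewrite paddr_eq0 ?sumr_ge0// => /andP[/eqP qs].
  rewrite normr_eq0 subr_eq0 => /eqP qr <-; split; first exact: qK.1.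
  exact: fixed_eigenpair.
apply: (compact_closed (@norm_hausdorff _ _)); apply: continuous_compact.
  by apply: continuous_subspaceT => q; exact: continuous_fst.
apply: compact_closedI; first exact: compact_sphere_cube.
apply: closed_zeros => q; apply: continuous_at_add; first exact: continuous_sign_defect.
apply: continuous_at_norm; apply: continuous_at_subv.
  apply: (@continuous_comp _ _ _ arg res); first exact: continuous_arg.
  exact: continuous_resolvent.
apply: continuous_at_mkrow => i; apply: continuous_at_mul; first exact: continuous_at_cst.
by apply: continuous_at_coord; exact: continuous_snd.
Qed.

Variables (r m : nat) (Psi : 'rV[R]_n -> 'rV[R]_r) (L : 'rV[R]_n -> 'rV[R]_m).
Hypothesis Psi_cont : continuous Psi.
Hypothesis Psi_odd : forall x, Psi (- x) = - Psi x.
Hypothesis Psi_neq0 : forall x, `|x| = 1 -> eigenpair G 1 lam x -> Psi x <> 0.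
Hypothesis L_cont : continuous L.
Hypothesis L_odd : forall x, L (- x) = - L x.
Hypothesis L_energy : forall x, L x = 0 -> 0 <= energy G 1 x - lam * mass G 1 x.

Let F' (q : 'rV[R]_n * 'rV[R]_n) : 'rV[R]_(r + m) :=
  row_mx (Psi q.1) (L (arg q - res (arg q))).

Let continuous_F' : continuous F'.
Proof.
move=> q; apply: continuous_at_row_mx.
  apply: (@continuous_comp _ _ _ (fun q : 'rV[R]_n * 'rV[R]_n => q.1) Psi).
    exact: continuous_fst.
  exact: Psi_cont.
apply: (@continuous_comp _ _ _ (fun q => arg q - res (arg q)) L); last exact: L_cont.
apply: continuous_at_subv; first exact: continuous_arg.
apply: (@continuous_comp _ _ _ arg res); first exact: continuous_arg.
exact: continuous_resolvent.
Qed.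

(** The step decreases [J] by at least the squared norm of [res (arg q) - vweight q.2], which is
    nonzero because [Psi] has no zero at unit eigenfunctions; and it ends where [J >= 0]. *)
Let F'_eq0 q : sphere_cube q -> sign_defect q = 0 -> F' q = 0 -> lam < RQ G 1 q.1.
Proof.
move=> qK qs /row_mx_eq0P[Psi0 L0]; have q0 := norm1_neq0 qK.1.
rewrite ltNge RQ_le// -ltNge; set y := arg q - _ in L0.
apply: (le_lt_trans (L_energy L0)).
have := @energy_mass_decrease _ _ _ 1 G_inputs (lexx 1) lam q.1 y
  (resolvent_weights G_inputs (arg q)) (fun i => q.2 0 i) lam_ge0.
move=> /(_ (@resolvent_weightsP _ _ _ G_inputs (arg q)) (sgn_graph qK qs)).
apply: lt_le_trans; rewrite ltrDl mul1r.
have -> : \sum_i (divergence G (resolvent_weights G_inputs (arg q)) i -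
    lam * (deg G i)%:R * q.2 0 i) * (q.1 - y) 0 i =
  \sum_i (res (arg q) - vweight q.2) 0 i ^+ 2.
  apply: eq_bigr => i _; have -> : q.1 - y = res (arg q) - vweight q.2.
    have subK (a b c : 'rV[R]_n) : a - (a + b - c) = c - b.
      by rewrite opprB opprD addrCA [a + _]addrA subrr add0r.
    exact: subK.
  by rewrite !mxE expr2.
apply: sum_sqr_gt0 => /eqP; rewrite subr_eq0 => /eqP rq.
exact: (Psi_neq0 qK.1 (fixed_eigenpair qK qs rq)).
Qed.

(** For [d > 0], [soft d x] and [soft_sgn d x] form a pair in the graph of [Sgn] that depends
    continuously on [x]. *)
Let soft d x : 'rV[R]_n := \row_i (x 0 i - clamp d (x 0 i)).
Let soft_sgn d x : 'rV[R]_n := \row_i (clamp d (x 0 i) / d).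

Let continuous_at_clamp (T : topologicalType) (d t : T -> R) u :
  {for u, continuous d} -> {for u, continuous t} ->
  {for u, continuous (fun u => clamp (d u) (t u))}.
Proof.
move=> dc tc; apply: continuous_at_max; first exact: continuous_at_opp.
exact: continuous_at_min.
Qed.

Let continuous_at_soft (T : topologicalType) (d : T -> R) (g : T -> 'rV[R]_n) u :
  {for u, continuous d} -> {for u, continuous g} ->
  {for u, continuous (fun u => soft (d u) (g u))}.
Proof.
move=> dc gc; apply: continuous_at_mkrow => i.
have gci := @continuous_at_coord _ _ _ _ i _ gc.
apply: continuous_at_add => //; apply: continuous_at_opp; exact: continuous_at_clamp.
Qed.

Let soft0 x : soft 0 x = x.
Proof. by apply/rowP => i; rewrite mxE clamp0 subr0. Qed.

Lemma nonsmooth_deformation : exists mu (F : 'rV[R]_n -> 'rV[R]_(r + m)),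
  [/\ lam < mu, continuous F, forall x, F (- x) = - F x &
      forall x, `|x| = 1 -> RQ G 1 x < mu -> F x <> 0].
Proof.
have [mu lam_mu hmu] : exists2 mu, lam < mu & forall q,
    (sphere_cube `&` [set q | sign_defect q + `|F' q| = 0]) q -> mu <= RQ G 1 q.1.
  apply: compact_gap.
  - apply: compact_closedI; first exact: compact_sphere_cube.
    apply: closed_zeros => q; apply: continuous_at_add; first exact: continuous_sign_defect.
    by apply: continuous_at_norm; exact: continuous_F'.
  - move=> q [qK _].
    exact: (@continuous_at_RQ R n G ('rV[R]_n * 'rV[R]_n)%type 1 fst q deg_gt0 ltr01
      (norm1_neq0 qK.1) (@continuous_fst q)).
  - move=> q [qK /= /eqP]; rewrite paddr_eq0 ?sumr_ge0// => /andP[/eqP qs].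
    by rewrite normr_eq0 => /eqP; exact: F'_eq0.
pose eps := (mu - lam) / 2; have eps0 : 0 < eps by rewrite divr_gt0// subr_gt0.
(* For a small threshold, [soft s x] stays away from zero and its [RQ] exceeds that of [x] by less
   than [eps], uniformly on the sphere. *)
have [e e0 he] : exists2 e, 0 < e & forall s, 0 < s < e ->
    forall x, [set x : 'rV[R]_n | `|x| = 1] x ->
    0 < Num.min (`|soft s x| - 2^-1) (RQ G 1 x + eps - RQ G 1 (soft s x)).
  apply: (@compact_small_parameter _ _ _ (fun q : 'rV[R]_n * R =>
    Num.min (`|soft q.2 q.1| - 2^-1) (RQ G 1 q.1 + eps - RQ G 1 (soft q.2 q.1)))).
  - exact: sphere_compact.
  - move=> x /= x1; have x0 := norm1_neq0 x1.
    have c1 : {for (x, 0), continuous (fun q : 'rV[R]_n * R => q.1)} by exact: cvg_fst.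
    have c2 : {for (x, 0), continuous (fun q : 'rV[R]_n * R => q.2)} by exact: cvg_snd.
    have cs := continuous_at_soft c2 c1.
    apply: continuous_at_min.
      apply: continuous_at_add; last exact: continuous_at_cst.
      exact: continuous_at_norm.
    apply: continuous_at_add; first apply: continuous_at_add.
    + exact: (continuous_at_RQ deg_gt0 ltr01 _ c1).
    + exact: continuous_at_cst.
    + apply: continuous_at_opp; apply: (continuous_at_RQ deg_gt0 ltr01 _ cs).
      by rewrite /= soft0.
  - move=> x /= x1; rewrite soft0 x1 addrAC subrr add0r lt_min eps0 andbT.
    by lra.
pose d := e / 2; have d0 : 0 < d by rewrite divr_gt0.
have de : 0 < d < e by rewrite d0 /d ltr_pdivrMr// ltr_pMr// ltr1n.
(* The maximum with [2^-1] keeps [W] continuous where [soft d x] vanishes; on the unit sphere it is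
   the norm of [soft d x]. *)
pose W x := (Num.max `|soft d x| 2^-1)^-1 *: soft d x.
pose F x := F' (W x, soft_sgn d x).
have softN x : soft d (- x) = - soft d x.
  by apply/rowP => i; rewrite !mxE clampN ?ltW//; ring.
have WN x : W (- x) = - W x by rewrite /W softN normrN scalerN.
have sgnN x : soft_sgn d (- x) = - soft_sgn d x.
  by apply/rowP => i; rewrite !mxE clampN ?ltW// mulNr.
(* As [lam + 2 eps = mu], a unit vector with [RQ x < lam + eps] has [RQ (W x) < mu]. *)
exists (lam + eps), F; split.
- by rewrite ltrDl.
- move=> x; have cid : {for x, continuous (fun y : 'rV[R]_n => y)} by exact: cvg_id.
  have cs : {for x, continuous (soft d)}.
    by apply: continuous_at_soft => //; exact: continuous_at_cst.
  apply: (@continuous_comp _ _ _ (fun x => (W x, soft_sgn d x)) F'); last exact: continuous_F'.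
  apply: continuous_at_pair.
    apply: continuous_at_scale => //; apply: continuous_at_inv.
      by rewrite gt_eqF// lt_max invr_gt0 ltr0n orbT.
    apply: continuous_at_max; last exact: continuous_at_cst.
    exact: continuous_at_norm.
  apply: continuous_at_mkrow => i; apply: continuous_at_mul; last exact: continuous_at_cst.
  apply: continuous_at_clamp; first exact: continuous_at_cst.
  exact: continuous_at_coord.
- move=> x; rewrite /F /F' /= WN sgnN Psi_odd.
  have -> : arg (- W x, - soft_sgn d x) = - arg (W x, soft_sgn d x).
    by apply/rowP => i; rewrite !mxE mulrN opprD.
  by rewrite /res resolventN -opprD L_odd opp_row_mx.
- move=> x x1 xmu Fx; have := he d de x x1; rewrite lt_min => /andP[].
  rewrite subr_gt0 => s12; rewrite subr_gt0 => RQs.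
  have s0 : soft d x <> 0.
    by move=> s0; move: s12; rewrite s0 normr0; lra.
  have WE : W x = `|soft d x|^-1 *: soft d x by rewrite /W max_l// ltW.
  have W1 : `|W x| = 1 by rewrite WE norm_normalize.
  have WRQ : RQ G 1 (W x) < mu.
    by rewrite WE RQZ ?normalize_neq0//; rewrite /eps in xmu RQs; lra.
  have := hmu (W x, soft_sgn d x); rewrite leNgt /= WRQ => /(_ _)/negP; apply => //.
  split.
    split=> //= i; rewrite mxE in_itv /= -ler_norml normrM normfV (gtr0_norm d0).
    by rewrite ler_pdivrMr// mul1r clamp_bound// ltW.
  rewrite /= -/(F x) Fx normr0 addr0; apply/sign_defect_eq0 => i /=.
  rewrite WE !mxE mulrCA clamp_soft// normrM ger0_norm//.
Qed.

End NonsmoothDeformation.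

(** * Conclusion *)

Lemma continuous_nodal_form (R : realType) n (f : 'rV[R]_n) rep i :
  continuous (nodal_form f rep i).
Proof.
move=> x; have [fi|fi] := eqVneq (f 0 i) 0.
  apply: (@eq_continuous_at _ _ (fun y : 'rV[R]_n => y 0 i)); last exact: coord_continuous.
  by move=> y; rewrite /nodal_form fi eqxx.
apply: (@eq_continuous_at _ _
  (fun y : 'rV[R]_n => y 0 i * f 0 (rep i) - y 0 (rep i) * f 0 i)).
  by move=> y; rewrite /nodal_form (negbTE fi).
apply: continuous_at_add; last apply: continuous_at_opp; apply: continuous_at_mul;
  by [exact: coord_continuous|exact: continuous_at_cst].
Qed.

Lemma eigenpair_deformation (R : realType) n (G : ohypergraph n) (p lam : R)
    (f : 'rV[R]_n) r m (L : 'rV[R]_n -> 'rV[R]_m) :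
  inputs_only G -> (forall i, (0 < deg G i)%N) -> 1 <= p ->
  eigenpair G p lam f -> multiplicity G p lam = r ->
  continuous L -> (forall x, L (- x) = - L x) ->
  (forall x, L x = 0 -> 0 <= energy G p x - lam * mass G p x) ->
  exists mu (F : 'rV[R]_n -> 'rV[R]_(r + m)),
  [/\ lam < mu, continuous F, forall x, F (- x) = - F x &
      forall x, `|x| = 1 -> RQ G p x < mu -> F x <> 0].
Proof.
move=> Gin Gdeg p1 ef rE Lc Lodd Len.
have lam0 := eigenvalue_ge0 Gin Gdeg p1 ef.
pose E := [set x : 'rV[R]_n | `|x| = 1 /\ eigenpair G p lam x].
have clE : closed E.
  rewrite /E; have [p_eq1|p_neq1] := eqVneq p 1.
    by rewrite p_eq1; exact: closed_eigenpair_1.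
  by apply: closed_eigenpair_gt1 => //; rewrite lt_neqAle eq_sym p_neq1.
have ES : E `<=` [set x | eigenpair G p lam x] `\ 0.
  by move=> x [x1 ex]; split=> //; exact: norm1_neq0.
have symE : centrally_symmetric E.
  by move=> x [x1 ex]; split; [rewrite normrN|exact: eigenpairN].
(* The set of eigenfunctions contains [f], so its genus is attained by an odd map. *)
have odd_r : odd_map_to_sphere [set x | eigenpair G p lam x] r.
  rewrite -rE; suff [] : is_least_dim [set x | eigenpair G p lam x] (multiplicity G p lam) by [].
  by apply: (@is_least_dim_genus _ _ _ f); split=> //; exact: ef.1.
have [Psi [Psic Psiodd Psi0]] := odd_extension clE ES symE odd_r.
have {}Psi0 x : `|x| = 1 -> eigenpair G p lam x -> Psi x <> 0.
  by move=> x1 ex; apply: Psi0.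
have [p_eq1|p_neq1] := eqVneq p 1; last first.
  by apply: (smooth_deformation Gin Gdeg _ lam0 Psic) => //; rewrite lt_neqAle eq_sym p_neq1.
by rewrite p_eq1 in Psi0 Len *; exact: (nonsmooth_deformation Gin Gdeg lam0 Psic).
Qed.

Theorem theorem5p4 (R : realType) (n : nat) (G : ohypergraph n) (p : R)
    (k r : nat) (lam : R) (f : 'rV[R]_n)
    (hinputs : inputs_only G)
    (hdeg : forall i : 'I_n, (0 < deg G i)%N)
    (hp : 1 <= p)
    (hk : (1 <= k <= n)%N)
    (hlam : minmax_eigenvalue G p k = lam%:E)
    (hf : eigenpair G p lam f)
    (hr : multiplicity G p lam = r) :
  (#|pos_nodal_domains G f| + #|neg_nodal_domains G f| <= n - k + r)%N.
Proof.
have [I [rep [cardI repI rep_neq0 rep_adj]]] := nodal_representatives G f.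
(* The linear map [pi], with [n - m] coordinates. *)
pose L x : 'rV[R]_#|I| := \row_j nodal_form f rep (enum_val j) x.
have Lc : continuous L.
  by move=> x; apply: continuous_at_mkrow => j; exact: continuous_nodal_form.
have Lodd x : L (- x) = - L x by apply/rowP => j; rewrite !mxE nodal_formN.
have Len x : L x = 0 -> 0 <= energy G p x - lam * mass G p x.
  move=> /rowP L0; apply: (nodal_form_energy hinputs hdeg hp hf repI) => // i iI.
  by have := L0 (enum_rank_in iI i); rewrite !mxE enum_rankK_in.
have [mu [F [lam_mu Fc Fodd F0]]] := eigenpair_deformation hinputs hdeg hp hf hr Lc Lodd Len.
case/andP: hk => k0 kn.
(* This gives [k <= r + #|I|], and [#|I| + m = n]; the truncated difference [n - k] is exact as
   [k <= n]. *)
have := minmax_leq hdeg k0 hlam lam_mu Fc Fodd F0.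
by lia.
Qed.
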